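(* Let $\Omega\subset\mathbb{R}^n$ be a bounded domain and let $u_\infty$ be a variational solution of the $\infty$-Laplace equation in $\Omega$. If $u_\infty\ge 0$ in $\Omega$, then $$u_\infty(x)\le u_\infty(y)\exp\Bigl(\frac{|x-y|}{R-r}\Bigr)$$ whenever $x,y\in B(x_0,r)$, $0<r<R$ and $\overline{B(x_0,R)}\subset\Omega$.
   Context: A variational solution of the $\infty$-Laplace equation in a bounded domain $\Omega$ is a function $u_\infty\in C(\overline{\Omega})$ obtained as follows. Let $g\in C(\overline{\Omega})\cap W^{1,\infty}(\Omega)$ have Lipschitz continuous boundary values. For $p>n$ (and $p\ge 2$) let $u_p$ be the unique minimizer of $\int_\Omega|\nabla v|^p\,dx$ among all $v\in C(\overline{\Omega})\cap W^{1,p}(\Omega)$ with $v=g$ on $\partial\Omega$ (equivalently, the weak solution of $\nabla\cdot(|\nabla u|^{p-2}\nabla u)=0$ with boundary values $g$). Then $u_\infty=\lim_{j\to\infty}u_{p_j}$ uniformly in $\overline{\Omega}$ for some sequence $p_j\to\infty$. Here $B(x_0,r)$ is the open ball with center $x_0$ and radius $r$. *)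

(* Defs.v *)
From HB Require Import structures.
From mathcomp Require Import all_boot all_order all_algebra.
From mathcomp Require Import all_classical all_reals all_analysis measurable_realfun.
Import Order.TTheory GRing.Theory Num.Theory.
Import numFieldNormedType.Exports.

Set Implicit Arguments.
Unset Strict Implicit.
Unset Printing Implicit Defensive.

Local Open Scope classical_set_scope.
Local Open Scope ring_scope.

Definition measure_rV_display : measure_display.
Proof. exact: default_measure_display. Qed.

(* The sigma-algebra on R^n generated by the coordinate maps, as the library
   does for [n.-tuple R]; it is the Borel one, see [open_measurable_rV]. *)
Section measurable_rV.
Context {R : realType}.
Variable n : nat.

Let coords : 'I_n -> 'rV[R]_n -> measurableTypeR R := fun i x => x ord0 i.

Let rV_set0 : g_sigma_preimage coords set0.
Proof. exact: sigma_algebra0. Qed.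

Let rV_setC A : g_sigma_preimage coords A -> g_sigma_preimage coords (~` A).
Proof. exact: sigma_algebraC. Qed.

Let rV_bigcup (F : _^nat) : (forall i, g_sigma_preimage coords (F i)) ->
  g_sigma_preimage coords (\bigcup_i (F i)).
Proof. exact: sigma_algebra_bigcup. Qed.

HB.instance Definition _ := @isMeasurable.Build measure_rV_display
  'rV[R]_n (g_sigma_preimage coords) rV_set0 rV_setC rV_bigcup.

Lemma measurable_rV_coord (i : 'I_n) :
  measurable_fun [set: 'rV[R]_n] (fun x : 'rV[R]_n => x ord0 i : measurableTypeR R).
Proof.
move=> _ Y mY; rewrite setTI; apply: sub_sigma_algebra => /=.
rewrite -bigcup_seq/=; exists i => /=; first by rewrite mem_index_enum.
by exists Y => //; rewrite setTI.
Qed.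

Lemma measurable_fun_rVP d (T : measurableType d) (f : T -> 'rV[R]_n) :
  (forall i, measurable_fun [set: T] (fun x => f x ord0 i : measurableTypeR R)) ->
  measurable_fun [set: T] f.
Proof.
move=> mf; suff H : (@measurable _ 'rV[R]_n) `<=`
    [set A | measurable (f @^-1` A)] by move=> _ A mA; rewrite setTI; exact: H.
apply: smallest_sub.
  split => /=.
  - by rewrite preimage_set0.
  - by move=> A mA; rewrite setTD preimage_setC; exact: measurableC.
  - by move=> F mF; rewrite preimage_bigcup; exact: bigcupT_measurable.
rewrite -bigcup_seq => A [i _ [B mB <-]] /=.
by rewrite setTI; have := mf i measurableT B mB; rewrite setTI.
Qed.

Lemma open_measurable_rV (U : set 'rV[R]_n) : open U -> measurable U.
Proof.
move=> oU.
pose box (q : 'rV[rat]_n * nat) : set 'rV[R]_n :=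
  [set x | forall i, ball (ratr (q.1 ord0 i) : R) (q.2.+1%:R^-1) (x ord0 i)].
have mbox q : measurable (box q).
  have -> : box q = \bigcap_(i in [set: 'I_n])
      [set x | ball (ratr (q.1 ord0 i) : R) (q.2.+1%:R^-1) (x ord0 i)].
    by apply/seteqP; split=> [x xq i _|x xq i]; exact: xq.
  apply: fin_bigcap_measurable => // i _.
  have := measurable_rV_coord i measurableT (measurable_ball (ratr (q.1 ord0 i)) q.2.+1%:R^-1).
  by rewrite setTI.
pose F k : set 'rV[R]_n := if unpickle k is Some q then
  (if `[< box q `<=` U >] then box q else set0) else set0.
suff -> : U = \bigcup_k F k.
  apply: bigcupT_measurable => k; rewrite /F; case: unpickle => // q.
  by case: ifP => // _; exact: mbox.
apply/seteqP; split => [x Ux|x [k _]]; last first.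
  by rewrite /F; case: unpickle => [q|//]; case: asboolP => [qU xq|//]; exact: qU.
have /nbhs_ballP[e /= e0 eU] : nbhs x U by exact: open_nbhs_nbhs.
have [k ke] : exists k : nat, k.+1%:R^-1 < e / 2.
  have e20 : 0 < e / 2 by rewrite divr_gt0.
  have [k _ /(_ k (leqnn k))] := near_infty_natSinv_lt (PosNum e20).
  by exists k.
have rq (i : 'I_n) : exists q : rat, `|ratr q - x ord0 i| < k.+1%:R^-1.
  have B0 : ball (x ord0 i) k.+1%:R^-1 !=set0.
    by exists (x ord0 i); apply: ballxx; rewrite invr_gt0.
  have [|y [By [q _ qy]]] := @dense_rat R _ B0; first exact: ball_open.
  by exists q; rewrite qy distrC.
have [q qP] := choice rq.
exists (pickle (\row_i q i, k)) => //; rewrite /F pickleK.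
have -> : `[< box (\row_i q i, k) `<=` U >].
  apply/asboolP => y yB; apply: eU; split => // i j.
  rewrite !ord1 /ball/=.
  have := yB j; rewrite mxE /= /ball/= => yq.
  rewrite -(subrKA (ratr (q j))) (le_lt_trans (ler_normD _ _))//.
  rewrite [e]splitr ltrD// (lt_trans _ ke)// distrC; exact: qP.
by move=> i; rewrite mxE; exact: qP.
Qed.

End measurable_rV.

Definition rV_cons {R : realType} n (x : measurableTypeR R * 'rV[R]_n) :
  'rV[R]_n.+1 := row_mx (x.1 : R)%:M x.2 : 'rV[R]_(1 + n).

Section lebesgue_rV_step.
Context {R : realType} (n : nat).
Variable mu : {sigma_finite_measure set 'rV[R]_n -> \bar R}.

Lemma rV_cons0 (x : measurableTypeR R * 'rV[R]_n) : rV_cons x ord0 ord0 = x.1.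
Proof.
rewrite /rV_cons (_ : ord0 = lshift n (ord0 : 'I_1)); last exact/val_inj.
by rewrite (row_mxEl (x.1%:M : 'rV[R]_1) x.2) mxE eqxx mulr1n.
Qed.

Lemma rV_consS (x : measurableTypeR R * 'rV[R]_n) (i : 'I_n) :
  rV_cons x ord0 (lift ord0 i) = x.2 ord0 i.
Proof.
rewrite /rV_cons (_ : lift ord0 i = rshift 1 i); last exact/val_inj.
by rewrite (row_mxEr (x.1%:M : 'rV[R]_1) x.2).
Qed.

Lemma measurable_rV_cons : measurable_fun setT (@rV_cons R n).
Proof.
apply: measurable_fun_rVP => i; case: (unliftP ord0 i) => [j ->|->].
  under eq_fun do rewrite rV_consS.
  exact: (measurableT_comp (measurable_rV_coord j)).
under eq_fun do rewrite rV_cons0.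
exact: measurable_fst.
Qed.

Definition lebesgue_rV_step : set 'rV[R]_n.+1 -> \bar R :=
  pushforward (lebesgue_measure \x mu)%E (@rV_cons R n).

Let step0 : lebesgue_rV_step set0 = 0%E.
Proof. by rewrite /lebesgue_rV_step /pushforward preimage_set0 measure0. Qed.

Let step_ge0 A : (0 <= lebesgue_rV_step A)%E.
Proof. exact: (measure_ge0 (lebesgue_measure \x mu)%E). Qed.

Let step_sigma_additive : semi_sigma_additive lebesgue_rV_step.
Proof.
have mpre A : measurable A -> measurable (@rV_cons R n @^-1` A).
  by move=> mA; rewrite -[X in measurable X]setTI; exact: measurable_rV_cons.
move=> F mF tF mUF; rewrite /lebesgue_rV_step /pushforward preimage_bigcup.
apply: (measure_semi_sigma_additive (s := (lebesgue_measure \x mu)%E)).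
- by move=> k; exact: mpre.
- apply/trivIsetP => i j _ _ ij; rewrite -preimage_setI.
  by move/trivIsetP : tF => /(_ _ _ I I ij) ->; rewrite preimage_set0.
- by rewrite -preimage_bigcup; exact: mpre.
Qed.

HB.instance Definition _ := isMeasure.Build _ _ _ lebesgue_rV_step
  step0 step_ge0 step_sigma_additive.

Let uncons (x : 'rV[R]_n.+1) : measurableTypeR R * 'rV[R]_n :=
  (x ord0 ord0, \row_i x ord0 (lift ord0 i)).

Let rV_consK : cancel (@rV_cons R n) uncons.
Proof.
move=> [a v]; rewrite /uncons rV_cons0; congr (_, _).
by apply/rowP => i; rewrite mxE rV_consS.
Qed.

Let measurable_uncons : measurable_fun setT uncons.
Proof.
apply/measurable_fun_pairP; split; first exact: measurable_rV_coord.
apply: measurable_fun_rVP => i.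
rewrite (_ : (fun _ => _) = fun x : 'rV[R]_n.+1 => x ord0 (lift ord0 i)).
  exact: measurable_rV_coord.
by apply/funext => x; rewrite /= mxE.
Qed.

Let step_sigma_finite : sigma_finite setT lebesgue_rV_step.
Proof.
have /sigma_finiteP[F [FT ndF Foo]] := sigma_finiteT (@lebesgue_measure R).
have /sigma_finiteP[G [GT ndG Goo]] := sigma_finiteT mu.
exists (fun k => uncons @^-1` (F k `*` G k)).
  apply/seteqP; split => // x _.
  have [i _ Fi] : (\bigcup_i F i) (uncons x).1 by rewrite -FT.
  have [j _ Gj] : (\bigcup_j G j) (uncons x).2 by rewrite -GT.
  exists (maxn i j) => //; split.
  - by move: Fi; exact/subsetPset/ndF/leq_maxl.
  - by move: Gj; exact/subsetPset/ndG/leq_maxr.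
move=> k; have [mF Fk] := Foo k; have [mG Gk] := Goo k; split.
  rewrite -[X in measurable X]setTI.
  by apply: measurable_uncons => //; exact: measurableX.
rewrite /lebesgue_rV_step /pushforward -comp_preimage.
rewrite (_ : uncons \o _ = id); last exact/funext/rV_consK.
by rewrite preimage_id product_measure1E// lte_mul_pinfty// ge0_fin_numE.
Qed.

HB.instance Definition _ := Measure_isSigmaFinite.Build _ _ _ lebesgue_rV_step
  step_sigma_finite.

End lebesgue_rV_step.

(* Characterized by its values on boxes, see [lebesgue_rV_box]. *)
Fixpoint lebesgue_rV {R : realType} (n : nat) :
    {sigma_finite_measure set 'rV[R]_n -> \bar R} :=
  if n is m.+1 then lebesgue_rV_step (lebesgue_rV m) else \d_(0 : 'rV[R]_0).

Lemma lebesgue_rV_box {R : realType} n (A : 'I_n -> set (measurableTypeR R)) :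
  (forall i, measurable (A i)) ->
  lebesgue_rV n [set x : 'rV[R]_n | forall i, A i (x ord0 i)] =
  (\prod_(i < n) lebesgue_measure (A i))%E.
Proof.
elim: n A => [|n IH] A mA.
  rewrite big_ord0 /= (_ : [set _ | _] = setT) ?diracT//.
  by apply/seteqP; split => // x _ [].
rewrite big_ord_recl /= -IH => [|i]; last exact: mA.
rewrite -product_measure1E//.
  rewrite /lebesgue_rV_step /pushforward; congr (product_measure1 _ _ _).
  apply/seteqP; split => -[a v] /=.
    move=> H; split; first by have := H ord0; rewrite rV_cons0.
    by move=> i; have := H (lift ord0 i); rewrite rV_consS.
  move=> [Aa Av] i; case: (unliftP ord0 i) => [j ->|->].
    by rewrite rV_consS.
  by rewrite rV_cons0.
rewrite (_ : mkset _ = \bigcap_(i in [set: 'I_n])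
   ((fun x : 'rV[R]_n => x ord0 i : measurableTypeR R) @^-1` A (lift ord0 i))).
  apply: fin_bigcap_measurable => // i _.
  by rewrite -[X in measurable X]setTI; exact: measurable_rV_coord.
by apply/seteqP; split=> [x xA i _|x xA i]; exact: xA.
Qed.

Section sobolev.
Context {R : realType} {n : nat}.
Implicit Types (Omega : set 'rV[R]_n) (u v g : 'rV[R]_n -> R)
  (Du Dv : 'rV[R]_n -> 'rV[R]_n) (p : R).

(* The Euclidean norm; the library's norm [`|x|] on ['rV[R]_n] is the sup norm,
   which defines the same topology and the same bounded sets. *)
Definition enorm (x : 'rV[R]_n) : R := Num.sqrt (\sum_(i < n) x ord0 i ^+ 2).

Definition eball (x0 : 'rV[R]_n) (r : R) : set 'rV[R]_n :=
  [set x | enorm (x - x0) < r].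

Definition boundary Omega : set 'rV[R]_n := closure Omega `\` Omega°.

Definition bounded_domain Omega : Prop :=
  [/\ open Omega, connected Omega, Omega !=set0 & bounded_set Omega].

Definition partial (i : 'I_n) (phi : 'rV[R]_n -> R) : 'rV[R]_n -> R :=
  fun x => 'D_(delta_mx ord0 i) phi x.

Definition smooth (phi : 'rV[R]_n -> R) : Prop :=
  forall s : seq 'I_n, let psi := foldr partial phi s in
    continuous psi /\ forall i x, derivable psi x (delta_mx ord0 i).

Definition test_function Omega (phi : 'rV[R]_n -> R) : Prop :=
  [/\ smooth phi, compact (closure [set x | phi x != 0]) &
      closure [set x | phi x != 0] `<=` Omega].

Definition weak_gradient Omega u Du : Prop :=
  forall phi, test_function Omega phi -> forall i : 'I_n,
    (\int[lebesgue_rV n]_(x in Omega) (u x * partial i phi x)%:E =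
     - \int[lebesgue_rV n]_(x in Omega) (Du x ord0 i * phi x)%:E)%E.

(* [u] is in W^{1,q}(Omega) with weak gradient [Du], for 1 <= q <= +oo; the
   extensions by 0 make the norms only see the values on [Omega]. *)
Definition sobolev1 Omega (q : \bar R) u Du : Prop :=
  [/\ u \_ Omega \in Lfun (lebesgue_rV n) q,
      forall i : 'I_n,
        (fun x => Du x ord0 i) \_ Omega \in Lfun (lebesgue_rV n) q &
      weak_gradient Omega u Du].

Definition admissible Omega p g v Dv : Prop :=
  [/\ {within closure Omega, continuous v}, sobolev1 Omega p%:E v Dv &
      {in boundary Omega, v =1 g}].

Definition energy Omega p Dv : \bar R :=
  (\int[lebesgue_rV n]_(x in Omega) (enorm (Dv x) `^ p)%:E)%E.

Definition p_minimizer Omega p g u : Prop :=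
  exists2 Du, admissible Omega p g u Du &
    forall v Dv, admissible Omega p g v Dv ->
      (energy Omega p Du <= energy Omega p Dv)%E.

Definition boundary_data Omega g : Prop :=
  [/\ {within closure Omega, continuous g},
      exists Dg, sobolev1 Omega +oo%E g Dg &
      exists L : R, {in boundary Omega &, forall x y,
        `|g x - g y| <= L * enorm (x - y)}].

Definition variational_solution Omega u : Prop :=
  {within closure Omega, continuous u} /\
  exists g (p : R^nat) (up : nat -> 'rV[R]_n -> R),
    [/\ boundary_data Omega g,
        forall j, n%:R < p j /\ 2 <= p j,
        p @ \oo --> +oo,
        forall j, p_minimizer Omega (p j) g (up j) &
        {uniform closure Omega, up @ \oo --> u}].

End sobolev.

(* Main.v *)
Require Import Defs.
From mathcomp Require Import all_boot all_order all_algebra.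
From mathcomp Require Import all_classical all_reals all_analysis.
From mathcomp Require Import measurable_realfun ring lra.
Import Order.TTheory GRing.Theory Num.Theory.
Import numFieldNormedType.Exports.

Set Implicit Arguments.
Unset Strict Implicit.
Unset Printing Implicit Defensive.

Local Open Scope classical_set_scope.
Local Open Scope ring_scope.

(** The inequality follows from comparison with cones: if the closed ball of
    radius rho around y lies in Omega then u(x) >= u(y) (1 - |x - y| / rho) in it
    ([cone_comparison]).  Along the segment from x to y every point is at distance
    more than rho = R - r from the complement of Omega; N steps of length
    |x - y| / N lose the factor (1 - |x - y| / (N rho))^N, which tends to
    exp (- |x - y| / rho).

    The cone inequality is proved for the minimizers u_p with a small error, and
    passes to the uniform limit.  The lower barrier for u_p is
    w(x) = A - B |x - y|^gamma with gamma < 1 close to 1, which is close to the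
    cone.  It satisfies div (|grad w|^(p-2) grad w) > 0 away from y as soon as
    (1 - gamma) (p - 1) > n - 1, hence for all large p: convexity of w in the
    radial direction outweighs its curvature in the other ones.  Suppose that
    w <= u_p near y and near the boundary of the ball, but not everywhere.  With
    P the positive part of w - u_p and M a bound for it, moving the gradient of
    u_p towards that of w by the fraction P / M is the effect of the competitor
    v = u_p + P^2 / (2 M).  By the tangent inequality for |.|^p
    ([enorm_powR_tangent]) the energy of v exceeds that of u_p by at most
      (p / M) * integral of P |grad w|^(p-2) grad w . (grad w - grad u_p)
      = - (p / (2 M)) * integral of P^2 div (|grad w|^(p-2) grad w) < 0,
    which contradicts minimality ([barrier_comparison]).

    Both v being a Sobolev function and the last integration by parts rest on one
    chain rule for weak derivatives, P^2 has weak gradient 2 P grad (w - u_p)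
    ([weak_partial_pos_sqr]).  It is obtained without mollifying Sobolev
    functions: for continuous z of bounded support with integrable weak partial
    derivative g, the difference quotients of z converge to g when they are
    integrated against continuous functions of bounded support, with an error
    controlled by the uniform size of those functions ([increment_bound],
    [increment_cvg]).  This holds for smooth test functions by differentiation
    under the integral, and carries over by uniform approximation
    ([smooth_approx]).  A second-order Taylor estimate for the square of the
    positive part then gives the chain rule. *)

(** * Translation invariance of Lebesgue measure *)

Lemma lebesgue_measure_shift (K : realType) (c : K) (A : set (measurableTypeR K)) :
  measurable A ->
  lebesgue_measure ((fun x : measurableTypeR K => (x + c : K)) @^-1` A)
  = lebesgue_measure A.
Proof.
move=> mA.
have mc : measurable_fun setT
    (fun x : measurableTypeR K => (x + c : K) : measurableTypeR K).
  by apply: measurable_funD => //; exact: measurable_id.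
pose mf := pushforward (@lebesgue_measure K)
  (fun x : measurableTypeR K => (x + c : K) : measurableTypeR K).
pose m := [the {measure set (measurableTypeR K) -> \bar K} of mf].
apply/esym/(@lebesgue_measure_unique K (m mc)) => // X [[a b]] /= _ <-.
rewrite /m /mf /= /pushforward.
have -> : (fun x : measurableTypeR K => (x + c : K) : measurableTypeR K)
    @^-1` `]a, b] = `]a - c, b - c]%classic.
  by apply/seteqP; split => x /=; rewrite !in_itv/= ltrBlDr lerBrDr.
by rewrite !lebesgue_measure_itv/= !lte_fin ltrD2r -!EFinD; case: ifP => // _; congr (_%:E); ring.
Qed.

Section translation.
Variable K : realType.

Lemma measurable_rV_shift n (c : 'rV[K]_n) :
  measurable_fun [set: 'rV[K]_n] (fun x => x + c).
Proof.
apply: measurable_fun_rVP => i.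
under eq_fun do rewrite mxE.
by apply: measurable_funD => //; exact: measurable_rV_coord.
Qed.

(** Induction on the dimension: a translation of R^(n+1) is a product of
    translations, and a measure with the values of the product measure on
    rectangles is the product measure. *)
Lemma lebesgue_rV_shift n (c : 'rV[K]_n) (A : set 'rV[K]_n) :
  measurable A -> lebesgue_rV n ((fun x => x + c) @^-1` A) = lebesgue_rV n A.
Proof.
elim: n c A => [|n IH] c A mA.
  congr (_ _); apply/seteqP; split => x /=; by rewrite [x + c](_ : _ = x)//; apply/rowP => -[].
rewrite /= /lebesgue_rV_step.
pose c' : 'rV[K]_n := \row_i c ord0 (lift ord0 i).
pose T (x : measurableTypeR K * 'rV[K]_n) : measurableTypeR K * 'rV[K]_n :=
  ((x.1 + c ord0 ord0 : K) : measurableTypeR K, x.2 + c').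
have mT : measurable_fun setT T.
  apply/measurable_fun_pairP; split => /=.
    by apply: measurable_funD => //; exact: measurable_fst.
  exact: (measurableT_comp (measurable_rV_shift c') measurable_snd).
pose mf := pushforward (lebesgue_measure \x lebesgue_rV n)%E T.
pose m := [the {measure set (measurableTypeR K * 'rV[K]_n) -> \bar K} of mf].
pose B := @rV_cons K n @^-1` A.
have mB : measurable B.
  by rewrite -[X in measurable X]setTI; exact: measurable_rV_cons.
have : (lebesgue_measure \x lebesgue_rV n)%E B = m mT B.
  apply: product_measure_unique => // X Y mX mY.
  rewrite /m /mf /= /pushforward.
  have -> : T @^-1` (X `*` Y) =
      ((fun x : measurableTypeR K => (x + c ord0 ord0 : K)) @^-1` X) `*`
      ((fun x => x + c') @^-1` Y) by [].
  rewrite product_measure1E/=.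
  - by rewrite lebesgue_measure_shift// IH.
  - rewrite -[X in measurable X]setTI.
    have : measurable_fun setT (fun x : measurableTypeR K => (x + c ord0 ord0 : K) : measurableTypeR K).
      by apply: measurable_funD => //; exact: measurable_id.
    by apply.
  - by rewrite -[X in measurable X]setTI; exact: measurable_rV_shift.
rewrite /m /mf /= /pushforward => ->; congr (_ _).
apply/seteqP; split => -[a v]; rewrite /B /T /=;
  suff -> : rV_cons (a + c ord0 ord0, v + c') = rV_cons (a, v) + c by [].
all: apply/rowP => i; case: (unliftP ord0 i) => [j ->|->].
all: by rewrite ?rV_consS ?rV_cons0 [RHS]mxE ?rV_consS ?rV_cons0/= ?mxE.
Qed.

End translation.

(** * Continuous functions with bounded support *)

Section Cc.
Variables (K : realType) (n : nat).
Notation mu := (lebesgue_rV n).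
Implicit Types (f g : 'rV[K]_n -> K) (c : 'rV[K]_n).

Lemma coord_le_norm (x : 'rV[K]_n) i : `|x ord0 i| <= `|x|.
Proof.
rewrite [leRHS]mx_normrE.
exact: (le_bigmax _ (fun ij => `|x ij.1 ij.2|) (ord0, i)).
Qed.

Lemma norm_le_coord (x : 'rV[K]_n) (M : K) : 0 <= M ->
  (forall i, `|x ord0 i| <= M) -> `|x| <= M.
Proof.
move=> M0 H; rewrite [leLHS]mx_normrE; apply: bigmax_le => // -[i j] _ /=.
by rewrite ord1.
Qed.

(** The sup norm may be used to express that the support is bounded. *)
Definition Cc f := continuous f /\ exists M : K, forall x, M < `|x| -> f x = 0.

Lemma continuous_measurable_rV f (D : set 'rV[K]_n) : continuous f -> measurable_fun D f.
Proof.
move=> cf; apply: measurable_funTS.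
apply: (measurability _ (RGenOpens.measurableE K)) => _ [_ [a [b ->] <-]].
rewrite setTI; apply: open_measurable_rV.
by apply: open_comp => [x _|]; [exact: cf|exact: interval_open].
Qed.

Lemma open_norm_gt (M : K) : open [set x : 'rV[K]_n | M < `|x| ].
Proof.
rewrite (_ : [set _ | _] = (fun x : 'rV[K]_n => `|x|) @^-1` [set t : K | M < t])//.
by apply: open_comp => [x _|]; [exact: norm_continuous|exact: open_gt].
Qed.

Lemma closed_norm_le (M : K) : closed [set x : 'rV[K]_n | `|x| <= M].
Proof.
rewrite (_ : [set _ | _] = (fun x : 'rV[K]_n => `|x|) @^-1` [set t : K | t <= M])//.
by apply: closed_comp => [x _|]; [exact: norm_continuous|exact: closed_le].
Qed.

Lemma measurable_rV_box (M : K) : measurable [set x : 'rV[K]_n | `|x| <= M].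
Proof.
rewrite (_ : [set _ | _] = ~` [set x | M < `|x|]); last first.
  by apply/seteqP; split => x /=; rewrite leNgt => /negP.
apply: measurableC; apply: open_measurable_rV; exact: open_norm_gt.
Qed.

Lemma lebesgue_rV_box_fin (M : K) : (mu ([set x : 'rV[K]_n | (`|x| <= M)%R]%classic) < +oo)%E.
Proof.
pose A (i : 'I_n) : set (measurableTypeR K) := `[- `|M|, `|M|]%classic.
apply: (@le_lt_trans _ _ (mu [set x : 'rV[K]_n | forall i, A i (x ord0 i)])).
  apply: le_measure; rewrite ?inE.
  - exact: measurable_rV_box.
  - rewrite (_ : mkset _ = \bigcap_(i in [set: 'I_n])
     ((fun x : 'rV[K]_n => x ord0 i : measurableTypeR K) @^-1` A i)).
      apply: fin_bigcap_measurable => // i _.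
      rewrite -[X in measurable X]setTI; apply: measurable_rV_coord => //.
      exact: measurable_itv.
    by apply/seteqP; split=> [x xA i _|x xA i]; exact: xA.
  - move=> x /= xM i; rewrite /A/= in_itv/= -ler_norml.
    apply: le_trans (le_trans xM (ler_norm _)).
    exact: coord_le_norm.
rewrite lebesgue_rV_box => [|i]; last exact: measurable_itv.
rewrite ltey_eq; apply/orP; left.
elim/big_ind : _ => // [a b|i _]; first exact: fin_numM.
by rewrite /A lebesgue_measure_itv/=; case: ifP.
Qed.

Lemma compact_rV_box (M : K) : compact [set x : 'rV[K]_n | `|x| <= M].
Proof.
apply: bounded_closed_compact.
  exists M; split; first exact: num_real.
  by move=> x Mx y /= yM; exact: le_trans yM (ltW Mx).
exact: closed_norm_le.
Qed.

Lemma continuous_bounded_box f (M : K) : continuous f ->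
  exists B, 0 <= B /\ forall x, `|x| <= M -> `|f x| <= B.
Proof.
move=> cf.
have := @continuous_compact _ _ f _ (continuous_subspaceT cf) (@compact_rV_box M).
move=> /compact_bounded [B [Br HB]].
exists (`|B| + 1); split; first by rewrite addr_ge0.
move=> x xM; apply: (HB (`|B| + 1)); last by exists x.
by rewrite (le_lt_trans (ler_norm _))// ltrDl.
Qed.

Lemma Cc_bounded f : Cc f -> exists B, 0 <= B /\ forall x, `|f x| <= B.
Proof.
move=> [cf [M fM]]; have [B [B0 HB]] := continuous_bounded_box M cf.
exists B; split => // x; have [/fM ->|/HB//] := ltP M `|x|.
by rewrite normr0.
Qed.

Lemma Cc_integrable f : Cc f -> mu.-integrable setT (EFin \o f).
Proof.
move=> fc; have [cf [M fM]] := fc; have [B [B0 HB]] := Cc_bounded fc.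
have mD := measurable_rV_box M.
have -> : EFin \o f = (EFin \o f) \_ [set x : 'rV[K]_n | `|x| <= M].
  apply/funext => x; rewrite patchE; case: ifPn => //.
  by rewrite notin_setE/= => /negP; rewrite -ltNge => /fM /= ->.
apply: (integrable_mkcond _ mD).1.
apply: (@measurable_bounded_integrable _ _ _ mu f) => //.
- exact: lebesgue_rV_box_fin.
- exact: continuous_measurable_rV.
- exists B; split; first exact: num_real.
  by move=> b Bb x _; exact: le_trans (HB x) (ltW Bb).
Qed.

Lemma Cc_shift f c : Cc f -> Cc (fun x => f (x + c)).
Proof.
move=> [cf [M fM]]; split.
  move=> x; apply: (@continuous_comp _ _ _ (fun x : 'rV[K]_n => x + c) f); last exact: cf.
  by apply: (@continuousD _ _ _ id (cst c)) => //; exact: cst_continuous.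
exists (M + `|c|) => x Mx; apply: fM.
have : `|x| <= `|x + c| + `|c| by rewrite -{1}(addrK c x) (le_trans (ler_normB _ _)).
lra.
Qed.

Lemma Cc_mull f g : Cc f -> continuous g -> Cc (fun x => f x * g x).
Proof.
move=> [cf [M fM]] cg; split; first by move=> x; apply: continuousM; [exact: cf|exact: cg].
by exists M => x /fM ->; rewrite mul0r.
Qed.

Lemma Cc_mulr f g : Cc f -> continuous g -> Cc (fun x => g x * f x).
Proof.
move=> fc cg; rewrite (_ : (fun x => _) = fun x => f x * g x); first exact: Cc_mull.
by apply/funext => x; rewrite mulrC.
Qed.

Lemma Cc_add f g : Cc f -> Cc g -> Cc (fun x => f x + g x).
Proof.
move=> [cf [M fM]] [cg [N gN]]; split; first by move=> x; apply: continuousD; [exact: cf|exact: cg].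
by exists (Num.max M N) => x; rewrite gt_max => /andP[/fM -> /gN ->]; rewrite addr0.
Qed.

Lemma Cc_scale f (a : K) : Cc f -> Cc (fun x => a * f x).
Proof. by move=> fc; apply: Cc_mulr => //; exact: cst_continuous. Qed.

Lemma Cc_opp f : Cc f -> Cc (fun x => - f x).
Proof.
move=> fc; rewrite (_ : (fun x => _) = fun x => (-1) * f x); first exact: Cc_scale.
by apply/funext => x; rewrite mulN1r.
Qed.

Lemma Cc_sub f g : Cc f -> Cc g -> Cc (fun x => f x - g x).
Proof. by move=> fc gc; apply: Cc_add => //; exact: Cc_opp. Qed.

(** Compactness in the form of near coverings gives uniformity in x for the
    increments by h near 0; one unit beyond the support there is nothing to prove. *)
Lemma Cc_uniform f (e : K) : Cc f -> 0 < e ->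
  exists2 d, 0 < d & forall x h, `|h| < d -> `|f (x + h) - f x| < e.
Proof.
move=> [cf [M fM]] e0.
have /compact_near_coveringP := @compact_rV_box (M + 1).
move=> /(_ 'rV[K]_n (nbhs (0 : 'rV[K]_n)) (fun h x => `|f (x + h) - f x| < e) _) cov.
have /nbhs_ballP[d /= d0 H] : \forall h \near (0 : 'rV[K]_n),
    [set x | `|x| <= M + 1] `<=` (fun x => `|f (x + h) - f x| < e).
  apply: cov => x _.
  have e20 : 0 < e / 2 by rewrite divr_gt0.
  have /cvgrPdist_lt/(_ _ e20)/nbhs_ballP[d /= d0 dH] := cf x; rewrite -ball_normE in dH.
  have d20 : 0 < d / 2 by rewrite divr_gt0.
  exists (ball x (d / 2), ball (0 : 'rV[K]_n) (d / 2)); first by split; exact: nbhsx_ballx.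
  move=> [x' h] /= []; rewrite -!ball_normE /= => xx'; rewrite sub0r normrN => h0.
  rewrite (_ : f (x' + h) - f x' = (f x - f x') - (f x - f (x' + h))); last by ring.
  rewrite (le_lt_trans (ler_normB _ _))// [e]splitr ltrD//; apply: dH => /=.
    by apply: lt_trans xx' _; lra.
  rewrite opprD addrA (le_lt_trans (ler_normB _ _))//; lra.
exists (Num.min d 1); first by rewrite lt_min d0/=.
move=> x h; rewrite lt_min => /andP[hd h1].
have [xM|xM] := leP `|x| (M + 1).
  by apply: (H h) => //=; rewrite -ball_normE /= sub0r normrN.
have : `|x| <= `|x + h| + `|h| by rewrite -{1}(addrK h x) (le_trans (ler_normB _ _)).
by move=> xh; rewrite !fM ?subrr ?normr0//; lra.
Qed.

Lemma Rintegral_shift f c : Cc f -> \int[mu]_x f (x + c) = \int[mu]_x f x.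
Proof.
move=> fc; rewrite /Rintegral; congr fine.
pose mf := pushforward mu (fun x : 'rV[K]_n => (x + c)%R).
pose m := [the {measure set 'rV[K]_n -> \bar K} of mf].
transitivity (\int[m (measurable_rV_shift c)]_y (f y)%:E)%E.
  rewrite (integral_pushforward (measurable_rV_shift c))//=.
  - by apply/measurable_EFinP; apply: continuous_measurable_rV; case: fc.
  - exact: (Cc_integrable (Cc_shift c fc)).
by apply: eq_measure_integral => A mA _; exact: (lebesgue_rV_shift c mA).
Qed.

End Cc.

(** * Smooth functions and uniform approximation by test functions *)

Section flat.
Variable K : realType.
Implicit Types t h : K.

(** For k = 0 the classical smooth function that is flat at 0. The powers of
    t^-1 make the family closed under differentiation, see [is_derive_flat]. *)
Definition flat (k : nat) t : K := if 0 < t then t^-1 ^+ k * expR (- t^-1) else 0.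

Lemma flat_le0 k t : t <= 0 -> flat k t = 0.
Proof. by rewrite /flat leNgt => /negbTE ->. Qed.

Lemma flat_ge0 k t : 0 <= flat k t.
Proof.
rewrite /flat; case: ifP => // t0.
by rewrite mulr_ge0 ?expR_ge0// exprn_ge0// invr_ge0 ltW.
Qed.

(** The bound u^(k+2) <= (k+2)! exp u at u = 1/t. A quadratic bound is what
    makes the derivative at 0 exist and vanish. *)
Lemma flat_quadratic k t : flat k t <= (k.+2)`!%:R * t ^+ 2.
Proof.
rewrite /flat; case: ifP => [t0|_]; last by rewrite mulr_ge0// sqr_ge0.
have ti0 : 0 <= t^-1 by rewrite invr_ge0 ltW.
have := expR_ge1Dxn k.+1 ti0.
set F := _%:R => H.
have F0 : 0 < F by rewrite ltr0n fact_gt0.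
have H2 : t^-1 ^+ k.+2 <= F * expR t^-1.
  rewrite mulrC -ler_pdivrMr//; apply: le_trans H; lra.
rewrite expRN -(ler_pM2r (expR_gt0 t^-1)) mulfVK ?gt_eqF ?expR_gt0//.
rewrite -(@ler_pM2r _ (t^-1 ^+ 2)) ?exprn_gt0 ?invr_gt0// -exprD addn2.
have -> : F * t ^+ 2 * expR t^-1 * t^-1 ^+ 2 = F * expR t^-1 * (t * t^-1) ^+ 2 by ring.
by rewrite mulfV ?gt_eqF// expr1n mulr1.
Qed.

(** The recursion stays in the family, so every [flat k] is smooth. *)
Lemma is_derive_flat k t :
  is_derive t 1 (flat k) (- k%:R * flat k.+1 t + flat k.+2 t).
Proof.
have [t0|t0|->] := ltgtP t 0.
- rewrite !flat_le0 ?ltW// mulr0 addr0.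
  have dc : is_derive t 1 (cst (0 : K)) (0 : K) by exact: is_derive_cst.
  apply: near_eq_is_derive dc.
  near=> s; rewrite flat_le0//=; apply: ltW.
  by near: s; exact: lt_nbhsl.
- have tN0 : t != 0 by rewrite gt_eqF.
  apply: (@near_eq_is_derive _ _ _ ((fun s : K => s^-1) ^+ k * (fun s => expR (- s^-1)))).
   near=> s; rewrite /flat ifT//; last by near: s; exact: lt_nbhsr.
    by rewrite exprfctE.
  have dV : is_derive t 1 (fun s : K => s^-1) (- t^-2).
    by have := @is_deriveV K id t 1 1 tN0 (is_derive_id _ _); rewrite /GRing.scale/= mulr1.
  have dN : is_derive t 1 (fun s : K => - s^-1) (t^-2).
    by have := is_deriveN dV; rewrite opprK.
  have dE : is_derive t 1 (fun s : K => expR (- s^-1)) (expR (- t^-1) * t^-2).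
    exact: (@is_derive1_comp _ expR (fun s : K => - s^-1)).
  have := is_deriveM (is_deriveX k dV) dE.
  move/is_derive_eq; apply.
  rewrite /flat t0 /= /GRing.scale/= !exprfctE.
  rewrite -!exprVn; case: k {dV dN dE} => [|k]; first by rewrite !expr0 !exprS expr0; ring.
  by rewrite [k.+1.-1]/=!exprS; ring.
- rewrite !flat_le0// mulr0 addr0.
  have F0 : 0 < (k.+2)`!%:R :> K by rewrite ltr0n fact_gt0.
  have cv : h^-1 *: (flat k (h *: 1 + 0) - flat k 0) @[h --> (0 : K)^'] --> (0 : K).
    apply/cvgrPdist_le => e e0.
    near=> h.
    rewrite sub0r normrN (@flat_le0 _ 0)// subr0 addr0 /GRing.scale/= mulr1.
    rewrite normrM normfV (ger0_norm (flat_ge0 _ _)).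
    have h0 : h != 0 by near: h; exact: nbhs_dnbhs_neq.
    have hh0 : 0 < `|h| by rewrite normr_gt0.
    rewrite mulrC ler_pdivrMr// (le_trans (flat_quadratic _ _))//.
    rewrite -real_normK ?num_real// expr2 mulrA ler_pM2r//.
    rewrite mulrC -ler_pdivlMr//.
    near: h; apply: dnbhs0_le.
    by rewrite divr_gt0.
  apply: DeriveDef; last by apply/cvg_lim.
  by apply/cvg_ex; exists 0.
Unshelve. all: by end_near.
Qed.

Lemma continuous_flat k : continuous (flat k).
Proof.
move=> t; apply: differentiable_continuous; apply/derivable1_diffP.
by have [] := is_derive_flat k t.
Qed.

End flat.

Section smooth.
Variables (K : realType) (n : nat).
Implicit Types (f g : 'rV[K]_n -> K).
Notation e_ i := (delta_mx (ord0 : 'I_1) i : 'rV[K]_n).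

(** Unlike [smooth], the recursion takes partial derivatives of the given
    function first, which is the order suited to inductions on the Leibniz rule. *)
Fixpoint Ck (k : nat) f : Prop :=
  if k is k'.+1 then
    [/\ continuous f, forall i x, derivable f x (e_ i) & forall i, Ck k' (partial i f)]
  else continuous f.

Lemma smooth_partial i f : smooth f -> smooth (partial i f).
Proof. by move=> sf s; have := sf (rcons s i); rewrite foldr_rcons. Qed.

Lemma smooth_continuous f : smooth f -> continuous f.
Proof. by move=> /(_ [::])[]. Qed.

Lemma smooth_derivable f i x : smooth f -> derivable f x (e_ i).
Proof. by move=> /(_ [::])[_]; exact. Qed.

Lemma smoothP f : smooth f <-> forall k, Ck k f.
Proof.
split => [sf k|].
  elim: k f sf => [|k IH] f sf /=; first exact: smooth_continuous.
  split; first exact: smooth_continuous.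
    by move=> i x; exact: smooth_derivable.
  by move=> i; apply: IH; exact: smooth_partial.
move=> Cf s; elim/last_ind: s f Cf => [|s i IH] f Cf.
  by have [] := Cf 1%N.
by rewrite foldr_rcons; apply: IH => k; have [_ _] := Cf k.+1; exact.
Qed.

Lemma CkW k f : Ck k.+1 f -> Ck k f.
Proof.
elim: k f => [|k IH] f; first by case.
by move=> [cf df pf]; split => // i; exact: IH.
Qed.

Lemma Ck_continuous k f : Ck k f -> continuous f.
Proof. by case: k => [//|k []]. Qed.

Lemma eq_Ck k f g : f =1 g -> Ck k f -> Ck k g.
Proof. by move=> /funext ->. Qed.

Lemma Ck_cst k (a : K) : Ck k (fun=> a).
Proof.
elim: k a => [|k IH] a /=; first exact: cst_continuous.
split; first exact: cst_continuous.
  by move=> i x; exact: derivable_cst.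
move=> i; apply: eq_Ck (IH 0) => x; rewrite /partial; exact/esym/derive_cst.
Qed.

Lemma is_derive_coord (x v : 'rV[K]_n) i :
  is_derive x v (fun y : 'rV[K]_n => y ord0 i) (v ord0 i).
Proof.
have cv : h^-1 *: ((h *: v + x) ord0 i - x ord0 i) @[h --> (0 : K)^'] --> v ord0 i.
  apply: (@cvg_trans _ ((fun=> v ord0 i) @ (0 : K)^')); last exact: cvg_cst.
  apply: near_eq_cvg; near=> h.
  have h0 : h != 0 by near: h; exact: nbhs_dnbhs_neq.
  by rewrite !mxE addrK /GRing.scale/= mulKf.
apply: DeriveDef; last by apply/cvg_lim.
by apply/cvg_ex; exists (v ord0 i).
Unshelve. all: by end_near.
Qed.

Lemma continuous_coord i : continuous (fun y : 'rV[K]_n => y ord0 i).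
Proof. exact: coord_continuous. Qed.

Lemma Ck_coord k i : Ck k (fun y : 'rV[K]_n => y ord0 i).
Proof.
case: k => [|k] /=; first exact: continuous_coord.
split; first exact: continuous_coord.
  by move=> j x; have [] := is_derive_coord x (e_ j) i.
move=> j; apply: eq_Ck (Ck_cst k ((e_ j) ord0 i)) => x.
by rewrite /partial; have [_ ->] := is_derive_coord x (e_ j) i.
Qed.

Lemma Ck_add k f g : Ck k f -> Ck k g -> Ck k (fun x => f x + g x).
Proof.
elim: k f g => [|k IH] f g /=.
  by move=> cf cg x; apply: continuousD; [exact: cf|exact: cg].
move=> [cf df pf] [cg dg pg]; split.
- by move=> x; apply: continuousD; [exact: cf|exact: cg].
- by move=> i x; exact: derivableD.
- move=> i; apply: eq_Ck (IH _ _ (pf i) (pg i)) => x.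
  by rewrite /partial deriveD.
Qed.

Lemma partialM i f g x : derivable f x (e_ i) -> derivable g x (e_ i) ->
  partial i (fun y => f y * g y) x = f x * partial i g x + g x * partial i f x.
Proof. by move=> df dg; rewrite /partial (deriveM df dg). Qed.

Lemma Ck_mul k f g : Ck k f -> Ck k g -> Ck k (fun x => f x * g x).
Proof.
elim: k f g => [|k IH] f g.
  by move=> cf cg x; apply: continuousM; [exact: cf|exact: cg].
move=> Cf Cg; have [cf df pf] := Cf; have [cg dg pg] := Cg; split.
- by move=> x; apply: continuousM; [exact: cf|exact: cg].
- by move=> i x; exact: derivableM.
- move=> i; apply: eq_Ck (Ck_add (IH _ _ (CkW Cf) (pg i)) (IH _ _ (CkW Cg) (pf i))) => x.
  by rewrite partialM.
Qed.

Lemma Ck_opp m f : Ck m f -> Ck m (fun x => - f x).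
Proof. by move=> Cf; apply: eq_Ck (Ck_mul (Ck_cst m (-1)) Cf) => x; rewrite mulN1r. Qed.

Lemma partial_near_cst i f (c : K) x : (\forall z \near x, f z = c) -> partial i f x = 0.
Proof.
move=> fc; have D : is_derive x (e_ i) f 0.
  apply: (near_eq_is_derive _ (is_derive_cst c x (e_ i))).
  by near=> z; rewrite /= (near fc z).
by have [_] := D.
Unshelve. all: by end_near.
Qed.

(** Directional derivatives are derivatives of functions of one real
    variable, which gives access to the one-dimensional chain rule. *)
Lemma is_derive_line (f : 'rV[K]_n -> K) x v df :
  is_derive x v f df <-> is_derive (0 : K) 1 (fun t => f (t *: v + x)) df.
Proof.
have E : (fun h : K => h^-1 *: ((f \o shift x) (h *: v) - f x)) =
    (fun h : K => h^-1 *: (((fun t => f (t *: v + x)) \o shift 0) (h *: 1) - f (0 *: v + x))).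
  apply/funext => h /=; rewrite addr0 scale0r add0r; congr (_ *: (f _ - _)).
  by rewrite [_ *: 1]mulr1.
split => -[d1 d2]; apply: DeriveDef.
- by move: d1; rewrite /derivable /= -?E; exact.
- by move: d2; rewrite /derive /= -?E; exact.
- by move: d1; rewrite /derivable /= -?E; exact.
- by move: d2; rewrite /derive /= -?E; exact.
Qed.

Lemma is_derive_comp (F : K -> K) f x v dF df :
  is_derive (f x) 1 F dF -> is_derive x v f df ->
  is_derive x v (F \o f) (dF * df).
Proof.
move=> hF /is_derive_line hf; apply/is_derive_line.
apply: (@is_derive1_comp _ F (fun t => f (t *: v + x))) => //.
by rewrite scale0r add0r.
Qed.

(** The statement for all k at once is what the induction needs, since
    differentiation raises k. *)
Lemma Ck_flat m k g : Ck m g -> Ck m (flat k \o g).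
Proof.
elim: m k g => [|m IH] k g.
  by move=> cg x; apply: continuous_comp; [exact: cg|exact: continuous_flat].
move=> Cg; have [cg dg pg] := Cg.
have D i x : is_derive x (e_ i) (flat k \o g)
    ((- k%:R * flat k.+1 (g x) + flat k.+2 (g x)) * partial i g x).
  by apply: is_derive_comp; [exact: is_derive_flat|apply/derivableP; exact: dg].
split.
- by move=> x; apply: continuous_comp; [exact: cg|exact: continuous_flat].
- by move=> i x; have [] := D i x.
- move=> i.
  apply: eq_Ck (Ck_mul (Ck_add (Ck_mul (Ck_cst m (- k%:R)) (IH k.+1 _ (CkW Cg))) (IH k.+2 _ (CkW Cg))) (pg i)) => x.
  by rewrite /partial; have [_ ->] := D i x.
Qed.

End smooth.

Section step.
Variables (K : realType).
Implicit Types t : K.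

(** Composing [flat 0] with itself, instead of dividing by
    flat 0 t + flat 0 (1 - t), keeps smoothness a matter of [Ck_flat]; the factor
    expR 1 is the inverse of [flat 0 1]. *)
Definition step t : K := 1 - expR 1 * flat 0 (1 - expR 1 * flat 0 t).

Let flat01 : flat 0 1 = (expR 1)^-1 :> K.
Proof. by rewrite /flat ltr01 expr0 mul1r invr1 expRN. Qed.

Let flat0_homo s t : s <= t -> flat 0 s <= flat 0 t.
Proof.
move=> st; have [s0|s0] := leP s 0; first by rewrite (flat_le0 _ s0) flat_ge0.
have t0 : 0 < t by exact: lt_le_trans st.
by rewrite /flat s0 t0 !expr0 !mul1r ler_expR lerN2 lef_pV2.
Qed.

Lemma step_le0 t : t <= 0 -> step t = 0.
Proof.
by move=> t0; rewrite /step (flat_le0 _ t0) mulr0 subr0 flat01 mulfV ?subrr// gt_eqF ?expR_gt0.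
Qed.

Lemma step_ge1 t : 1 <= t -> step t = 1.
Proof.
move=> t1; rewrite /step (@flat_le0 _ 0 (1 - _)) ?mulr0 ?subr0//.
rewrite subr_le0 (@le_trans _ _ (expR 1 * flat 0 1))//.
  by rewrite flat01 mulfV// gt_eqF ?expR_gt0.
by rewrite ler_wpM2l ?expR_ge0// flat0_homo.
Qed.

Lemma step_ge0 t : 0 <= step t.
Proof.
rewrite subr_ge0 (@le_trans _ _ (expR 1 * flat 0 1))//; last first.
  by rewrite flat01 mulfV// gt_eqF ?expR_gt0.
rewrite ler_wpM2l ?expR_ge0// flat0_homo// gerBl mulr_ge0 ?expR_ge0//.
exact: flat_ge0.
Qed.

Lemma step_le1 t : step t <= 1.
Proof. by rewrite gerBl mulr_ge0 ?expR_ge0// flat_ge0. Qed.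

(** A difference of steps, so that the integer translates telescope to 1. *)
Definition bump t : K := step (t + 1) - step t.

Lemma bump_ge0 t : 0 <= bump t.
Proof.
rewrite /bump; have [t0|t0] := leP t 0.
  by rewrite (step_le0 t0) subr0 step_ge0.
by rewrite (@step_ge1 (t + 1)) ?subr_ge0 ?step_le1//; lra.
Qed.

Lemma bump_supp t : bump t != 0 -> `|t| <= 1.
Proof.
apply: contra_neqT; rewrite -ltNge /bump ltr_normr => /orP[t1|t1].
  by rewrite !step_ge1 ?subrr//; lra.
by rewrite !step_le0 ?subrr//; lra.
Qed.

Lemma sum_bumpE (N : nat) t :
  \sum_(j < (N + N).+1) bump (t - (j%:R - N%:R)) = step (t + N%:R + 1) - step (t - N%:R).
Proof.
rewrite -(big_mkord xpredT (fun j => bump (t - (j%:R - N%:R)))).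
rewrite (@telescope_sumr_eq _ 0 (N + N).+1 (fun j => - step (t - (j%:R - N%:R) + 1)))//.
  rewrite opprK addrC sub0r opprK; congr (_ - step _).
  by rewrite -natr1 natrD; move: (N%:R : K) => b; ring.
move=> k _; rewrite /bump opprK addrC -natr1.
rewrite (_ : t - (k%:R + 1 - N%:R) + 1 = t - (k%:R - N%:R))//.
by move: (k%:R : K) (N%:R : K) => a b; ring.
Qed.

Lemma sum_bump (N : nat) t : `|t| <= N%:R ->
  \sum_(j < (N + N).+1) bump (t - (j%:R - N%:R)) = 1.
Proof.
rewrite ler_norml sum_bumpE => /andP[Nt tN].
by rewrite step_ge1 ?(@step_le0 (t - _)) ?subr0//; lra.
Qed.

Lemma sum_bump_le1 (N : nat) t : \sum_(j < (N + N).+1) bump (t - (j%:R - N%:R)) <= 1.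
Proof. by rewrite sum_bumpE (le_trans _ (step_le1 (t + N%:R + 1)))// gerBl step_ge0. Qed.

End step.

Section smooth_step.
Variables (K : realType) (n : nat).
Implicit Types (f g : 'rV[K]_n -> K).

Lemma Ck_step m f : Ck m f -> Ck m (fun x => step (f x)).
Proof.
move=> Cf.
have C1 := Ck_mul (Ck_cst n m (- expR 1)) (Ck_flat 0 Cf).
have C2 := Ck_flat 0 (Ck_add (Ck_cst n m 1) C1).
apply: eq_Ck (Ck_add (Ck_cst n m 1) (Ck_mul (Ck_cst n m (- expR 1)) C2)) => x.
by rewrite /step /= !mulNr.
Qed.

Lemma Ck_bump m f : Ck m f -> Ck m (fun x => bump (f x)).
Proof.
move=> Cf; have C1 := Ck_step (Ck_add Cf (Ck_cst n m 1)).
have C2 := Ck_mul (Ck_cst n m (-1)) (Ck_step Cf).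
by apply: eq_Ck (Ck_add C1 C2) => x; rewrite /bump mulN1r.
Qed.

Lemma Ck_prod m (I : Type) (r : seq I) (F : I -> 'rV[K]_n -> K) :
  (forall i, Ck m (F i)) -> Ck m (fun x => \prod_(i <- r) F i x).
Proof.
move=> CF; elim: r => [|i r IH].
  by apply: eq_Ck (Ck_cst n m 1) => x; rewrite big_nil.
by apply: eq_Ck (Ck_mul (CF i) IH) => x; rewrite big_cons.
Qed.

Lemma Ck_sum m (I : Type) (r : seq I) (F : I -> 'rV[K]_n -> K) :
  (forall i, Ck m (F i)) -> Ck m (fun x => \sum_(i <- r) F i x).
Proof.
move=> CF; elim: r => [|i r IH].
  by apply: eq_Ck (Ck_cst n m 0) => x; rewrite big_nil.
by apply: eq_Ck (Ck_add (CF i) IH) => x; rewrite big_cons.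
Qed.

Lemma vanish_compact_closure f (M : K) : (forall x, M < `|x| -> f x = 0) ->
  compact (closure [set x | f x != 0]).
Proof.
move=> fM; apply: (subclosed_compact _ (@compact_rV_box K n M)).
  exact: closed_closure.
rewrite [X in _ `<=` X](closure_id _).1; last exact: closed_norm_le.
apply: closure_subset => y /=.
by apply: contraNT; rewrite -ltNge => /fM ->.
Qed.

Lemma test_functionT f (M : K) : smooth f -> (forall x, M < `|x| -> f x = 0) ->
  test_function setT f.
Proof. by move=> sf fM; split => //; exact: vanish_compact_closure fM. Qed.

(** Interpolation on a grid of mesh [dl] by a tensor product partition of
    unity: where [f] does not vanish the approximation at x is an average of
    values of [f] at nodes within [dl], and elsewhere the weights sum to at most 1. *)
Lemma smooth_approx f (e : K) : Cc f -> 0 < e ->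
  exists2 psi, test_function setT psi & forall x, `|psi x - f x| <= e.
Proof.
move=> fc e0; have [d d0 fd] := Cc_uniform fc e0.
have [cf [M fM]] := fc.
pose dl := d / 2.
have dl0 : 0 < dl by rewrite divr_gt0.
(* the grid must cover the support, so that the bumps sum to 1 there *)
pose N := Num.bound (`|M| / dl).
have NM : `|M| / dl < N%:R by apply: archi_boundP; rewrite divr_ge0// ltW.
pose node (k : {ffun 'I_n -> 'I_(N + N).+1}) : 'rV[K]_n :=
  \row_i (dl * ((k i)%:R - N%:R)).
pose B (k : {ffun 'I_n -> 'I_(N + N).+1}) (x : 'rV[K]_n) : K :=
  \prod_i bump (dl^-1 * x ord0 i - ((k i)%:R - N%:R)).
pose psi x := \sum_k f (node k) * B k x.
have B0 k x : 0 <= B k x by apply: prodr_ge0 => i _; exact: bump_ge0.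
have Bsupp k x : B k x != 0 -> `|x - node k| <= dl.
  move=> /prodf_neq0 H; apply: norm_le_coord => [|i]; first exact: ltW.
  have := bump_supp (H i isT); rewrite !mxE => {}H.
  have -> : x ord0 i - dl * ((k i)%:R - N%:R) = dl * (dl^-1 * x ord0 i - ((k i)%:R - N%:R)).
    by rewrite [RHS]mulrBr mulVKf// gt_eqF.
  by rewrite normrM (gtr0_norm dl0) ger_pMr.
have BE x : \sum_k B k x = \prod_i \sum_(j < (N + N).+1) bump (dl^-1 * x ord0 i - (j%:R - N%:R)).
  by rewrite bigA_distr_bigA.
have B1 x : f x != 0 -> \sum_k B k x = 1.
  move=> fx; rewrite BE; apply: big1 => i _; apply: sum_bump.
  have xM : `|x| <= M by rewrite leNgt; apply: contra fx => /fM ->.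
  rewrite normrM (gtr0_norm (x := dl^-1)) ?invr_gt0// mulrC.
  rewrite (le_trans _ (ltW NM))// ler_pM2r ?invr_gt0//.
  exact: le_trans (coord_le_norm x i) (le_trans xM (ler_norm _)).
have Ble1 x : \sum_k B k x <= 1.
  rewrite BE; apply: prodr_ile1 => i _; rewrite sum_bump_le1 andbT.
  by apply: sumr_ge0 => j _; exact: bump_ge0.
exists psi.
  apply: (@test_functionT _ (M + dl)).
  apply/smoothP => m; apply: Ck_sum => k; apply: Ck_mul; first exact: (Ck_cst n m).
    apply: Ck_prod => i; apply: Ck_bump; apply: Ck_add; last exact: Ck_cst.
    by apply: Ck_mul; [exact: Ck_cst|exact: Ck_coord].
  move=> x Mx; apply: big1 => k _.
  have [->|/Bsupp xk] := eqVneq (B k x) 0; first by rewrite mulr0.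
  rewrite fM ?mul0r//.
  have : `|x| <= `|x - node k| + `|node k| by rewrite -{1}(subrK (node k) x) ler_normD.
  lra.
move=> x.
have -> : psi x - f x = \sum_k (f (node k) - f x) * B k x.
  under eq_bigr do rewrite mulrBl.
  rewrite sumrB -mulr_sumr; congr (_ - _).
  have [->|/B1 ->] := eqVneq (f x) 0; first by rewrite mul0r.
  by rewrite mulr1.
rewrite (le_trans (ler_norm_sum _ _ _))//.
apply: (@le_trans _ _ (\sum_k e * B k x)).
  apply: ler_sum => k _; rewrite normrM (ger0_norm (B0 k x)).
  have [->|/Bsupp xk] := eqVneq (B k x) 0; first by rewrite !mulr0.
  rewrite ler_wpM2r//; have := fd x (node k - x).
  rewrite (addrC x) subrK => H; apply: ltW; apply: H.
  by rewrite distrC; apply: le_lt_trans xk _; rewrite /dl; lra.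
by rewrite -mulr_sumr -[leRHS]mulr1 ler_pM2l.
Qed.

End smooth_step.

(** * Weak partial derivatives and a chain rule *)

Lemma integrable_cst_fin d (T : measurableType d) (K : realType)
    (mu : {measure set T -> \bar K}) (D : set T) (c : K) :
  measurable D -> (mu D < +oo)%E -> mu.-integrable D (EFin \o cst c).
Proof.
move=> mD Dfin; apply: measurable_bounded_integrable => //; exact: bounded_cst.
Qed.

Lemma Rintegral_sum d (X : measurableType d) (K : realType) (mu : {measure set X -> \bar K})
    (D : set X) (I : Type) (r : seq I) (f : I -> X -> K) : measurable D ->
  (forall i, mu.-integrable D (EFin \o f i)) ->
  mu.-integrable D (EFin \o (fun x => \sum_(i <- r) f i x)) /\
  \int[mu]_(x in D) (\sum_(i <- r) f i x) = \sum_(i <- r) \int[mu]_(x in D) f i x.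
Proof.
move=> mD fi; elim: r => [|i r [IH1 IH2]].
  have -> : (fun x => \sum_(i <- [::]) f i x) = cst (0 : K).
    by apply/funext => x; rewrite big_nil.
  rewrite big_nil; split; first exact: integrable0.
  by rewrite /Rintegral integral0.
have -> : (fun x => \sum_(j <- i :: r) f j x) = (fun x => f i x + \sum_(j <- r) f j x).
  by apply/funext => x; rewrite big_cons.
rewrite big_cons; split; last by rewrite RintegralD// IH2.
exact: (integrableD mD (fi i) IH1).
Qed.

Lemma Rintegral_vanish d (T : measurableType d) (K : realType)
    (mu : {measure set T -> \bar K}) (D : set T) (f : T -> K) :
  (forall x, ~ D x -> f x = 0) -> \int[mu]_(x in D) f x = \int[mu]_x f x.
Proof.
move=> f0; rewrite Rintegral_mkcond; apply: eq_Rintegral => x _.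
by rewrite patchE; case: ifPn => //; rewrite notin_setE => /f0.
Qed.

Section integrable_mul.
Context d (T : measurableType d) (K : realType).
Variable mu : {measure set T -> \bar K}.

Lemma integrable_mul_bounded (D : set T) (g f : T -> K) (C : K) : measurable D ->
  mu.-integrable D (EFin \o g) -> measurable_fun D f ->
  (forall x, D x -> `|f x| <= C) ->
  mu.-integrable D (EFin \o (fun x => g x * f x)).
Proof.
move=> mD ig mf fC.
have mg : measurable_fun D g by apply/measurable_EFinP; case/integrableP: ig.
have iC : mu.-integrable D (fun x => C%:E * (EFin \o (fun y => `|g y|%R)) x)%E.
  by apply: integrableZl => //; exact: integrable_norm.
apply: (le_integrable mD _ _ iC).
  by apply/measurable_EFinP; exact: measurable_funM.
move=> x Dx /=; rewrite lee_fin !normrM normr_id mulrC.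
by rewrite ler_wpM2r// (le_trans (fC _ Dx))// ler_norm.
Qed.

(** The elementary Hoelder inequality between L^1 and bounded functions. *)
Lemma Rintegral_mul_bound (D : set T) (g f : T -> K) (C : K) : measurable D ->
  mu.-integrable D (EFin \o g) -> measurable_fun D f ->
  (forall x, D x -> `|f x| <= C) ->
  `| \int[mu]_(x in D) (g x * f x) | <= C * \int[mu]_(x in D) `|g x|.
Proof.
move=> mD ig mf fC.
have ing : mu.-integrable D (EFin \o (fun x => `|g x|)) by exact: integrable_norm.
have im := integrable_mul_bounded mD ig mf fC.
rewrite (le_trans (le_normr_Rintegral mD im))//.
rewrite -RintegralZl//; apply: le_Rintegral => //.
- exact: integrable_norm.
- exact: (@integrableZl _ _ _ mu D mD C _ ing).
- by move=> x Dx; rewrite normrM mulrC ler_wpM2r// fC.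
Qed.

End integrable_mul.

Section directional.
Variables (K : realType) (n : nat).
Notation mu := (lebesgue_rV n).
Implicit Types (z g f phi psi : 'rV[K]_n -> K).
Notation e_ i := (delta_mx (ord0 : 'I_1) i : 'rV[K]_n).

Lemma norm_delta i : `|e_ i| <= 1.
Proof.
apply: norm_le_coord => // j; rewrite mxE eqxx/=.
by case: (j == i); rewrite ?normr1 ?normr0.
Qed.

Lemma norm_scale_delta (h : K) i : `|h *: e_ i| <= `|h|.
Proof. by rewrite normrZ ler_piMr// norm_delta. Qed.

Lemma is_derive0_cvg (F : K -> K) (L : K) : is_derive (0 : K) 1 F L ->
  h^-1 * (F h - F 0) @[h --> (0 : K)^'+] --> L.
Proof.
move=> [dF EF]; apply: cvg_dnbhs_at_right; rewrite -EF.
have cv : h^-1 *: ((F \o shift 0) (h *: 1) - F 0) @[h --> (0 : K)^'] --> 'D_1 F 0 := dF.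
rewrite (_ : (fun h => _) = (fun h => h^-1 *: ((F \o shift 0) (h *: 1) - F 0)))//.
by apply/funext => h /=; rewrite addr0 [_ *: 1]mulr1.
Qed.

Lemma Rintegral_scale0 V f i :
  \int[mu]_x (V x * f (x - 0 *: e_ i)) = \int[mu]_x (V x * f x).
Proof. by congr (Rintegral _ _ _); apply/funext => x; rewrite scale0r subr0. Qed.

Lemma partial_shift i f c x : partial i (fun y => f (y + c)) x = partial i f (x + c).
Proof.
rewrite /partial /derive; set A := (X in lim (X @ _)); set B := (X in _ = lim (X @ _)).
by suff -> : A = B by []; apply/funext => h; rewrite /A /B /= addrA.
Qed.

Lemma derivable_shift f c x v : derivable f (x + c) v -> derivable (fun y => f (y + c)) x v.
Proof.
rewrite /derivable.
rewrite (_ : (fun h => _) = (fun h : K => h^-1 *: (((fun y => f (y + c)) \o shift x) (h *: v) - f (x + c))))//.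
by apply/funext => h /=; rewrite addrA.
Qed.

Lemma continuous_shift f (c : 'rV[K]_n) : continuous f -> continuous (fun y : 'rV[K]_n => f (y + c)).
Proof.
move=> cf x; apply: (@continuous_comp _ _ _ (fun x : 'rV[K]_n => x + c) f); last exact: cf.
by apply: (@continuousD _ _ _ id (cst c)) => //; exact: cst_continuous.
Qed.

Lemma Ck_shift k f c : Ck k f -> Ck k (fun y => f (y + c)).
Proof.
elim: k f => [|k IH] f /=; first exact: continuous_shift.
move=> [cf df pf]; split; first exact: continuous_shift.
  by move=> i x; apply: derivable_shift.
by move=> i; apply: eq_Ck (IH _ (pf i)) => x; rewrite partial_shift.
Qed.

Lemma test_functionT_vanish f : test_function setT f -> exists M : K, forall x, M < `|x| -> f x = 0.
Proof.
move=> [_ /compact_bounded [M [_ HM]] _]; exists (M + 1) => x Mx.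
apply: contraTeq Mx => fx; rewrite -leNgt; apply: (HM (M + 1)); first by rewrite ltrDl.
exact: subset_closure.
Qed.

Lemma test_functionT_Cc f : test_function setT f -> Cc f.
Proof.
move=> tf; split; last exact: test_functionT_vanish.
by case: tf => sf _ _; exact: smooth_continuous.
Qed.

Lemma test_function_shift f c : test_function setT f -> test_function setT (fun x => f (x + c)).
Proof.
move=> tf; have [M HM] := test_functionT_vanish tf; have [sf _ _] := tf.
apply: (@test_functionT _ _ _ (M + `|c|)).
  by apply/smoothP => k; apply: Ck_shift; move: k; apply/smoothP.
move=> x Mx; apply: HM.
have : `|x| <= `|x + c| + `|c| by rewrite -{1}(addrK c x) (le_trans (ler_normB _ _)).
lra.
Qed.

Lemma is_derive_shift_line phi i x (t : K) : (forall y, derivable phi y (e_ i)) ->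
  is_derive t 1 (fun s : K => phi (x - s *: e_ i)) (- partial i phi (x - t *: e_ i)).
Proof.
move=> dphi; have /derivableP/is_derive_line := dphi (x - t *: e_ i).
set d := 'D_ _ _ _ => h.
have h1 : is_derive t 1 (fun s : K => t - s) (0 - 1 : K) by exact: is_deriveB.
have h2 : is_derive (t - t) 1 (fun s : K => phi (s *: e_ i + (x - t *: e_ i))) d by rewrite subrr.
have := @is_derive1_comp _ _ (fun s : K => t - s) t _ _ h2 h1; rewrite sub0r mulrN1.
rewrite (_ : _ \o _ = fun s : K => phi (x - s *: e_ i))//.
by apply/funext => s /=; congr (phi _); rewrite scalerBl addrCA; congr (_ + _); rewrite addrAC subrr sub0r.
Qed.

(** Differentiation under the integral; near t the difference quotients are
    dominated because [V] has bounded support. *)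
Lemma is_derive_convolution V phi i (t : K) : Cc V ->
  continuous phi -> (forall y, derivable phi y (e_ i)) -> continuous (partial i phi) ->
  is_derive t 1 (fun s : K => \int[mu]_x (V x * phi (x - s *: e_ i)))
    (- \int[mu]_x (V x * partial i phi (x - t *: e_ i))).
Proof.
move=> VC cphi dphi cdphi; have [cV [M VM]] := VC.
pose F (s : K) (x : 'rV[K]_n) := V x * phi (x - s *: e_ i).
have dF (s : K) (x : 'rV[K]_n) : is_derive s 1 (F^~ x) (V x * - partial i phi (x - s *: e_ i)).
  have := is_deriveZ (V x) (is_derive_shift_line x s dphi).
  exact.
have tI : `]t - 1, t + 1[%classic t by rewrite /= in_itv/= ltrBlDr !ltrDl ltr01.
have intF s : `]t - 1, t + 1[%classic s -> mu.-integrable setT (EFin \o F s).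
  by move=> _; apply: Cc_integrable; apply: Cc_mull => //; exact: continuous_shift.
have derF (s : K) (x : 'rV[K]_n) : `]t - 1, t + 1[%classic s -> setT x -> derivable (F^~ x) s 1.
  by move=> _ _; have [] := dF s x.
have [C [C0 HC]] := continuous_bounded_box (M + (`|t| + 1)) cdphi.
have GC : Cc (fun x => C * `|V x|).
  apply: Cc_scale; split; last by exists M => x /VM ->; rewrite normr0.
  by move=> x; apply: (@continuous_comp _ _ _ V); [exact: cV|exact: norm_continuous].
have G0 x : 0 <= C * `|V x| by rewrite mulr_ge0.
have Gub (s : K) (x : 'rV[K]_n) : `]t - 1, t + 1[%classic s -> setT x -> `|partial1of2 F s x| <= C * `|V x|.
  rewrite /= in_itv/= => /andP[ts st] _; rewrite partial1of2E; have [_ ->] := dF s x.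
  rewrite normrM normrN mulrC; have [xM|/VM ->] := leP `|x| M; last by rewrite normr0 !mulr0.
  rewrite ler_wpM2r// HC// (le_trans (ler_normB _ _))// lerD//.
  rewrite (le_trans (norm_scale_delta _ _))//.
  have : `|s| <= `|s - t| + `|t| by rewrite -{1}(subrK t s) ler_normD.
  have : `|s - t| <= 1 by rewrite ler_norml; lra.
  lra.
have iG := Cc_integrable GC.
apply: DeriveDef.
  exact: (derivable_under_integral measurableT tI intF derF G0 iG Gub).
have := differentiation_under_integral measurableT tI intF derF G0 iG Gub.
rewrite derive1E => ->.
under eq_Rintegral => x _ do rewrite partial1of2E.
under eq_Rintegral => x _ do (have [_ ->] := dF t x).
rewrite -mulN1r -RintegralZl//.
  by apply: eq_Rintegral => x _; ring.
apply: Cc_integrable; apply: (Cc_mull VC).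
exact: continuous_shift.
Qed.

Definition weak_partial i z g := forall phi, test_function setT phi ->
  \int[mu]_x (z x * partial i phi x) = - \int[mu]_x (g x * phi x).

(** Discrete integration by parts. *)
Lemma increment_shift z psi (c : 'rV[K]_n) : Cc z -> continuous psi ->
  \int[mu]_x ((z (x + c) - z x) * psi x) =
  \int[mu]_x (z x * psi (x - c)) - \int[mu]_x (z x * psi x).
Proof.
move=> zC cpsi.
have C1 : Cc (fun x => z x * psi (x - c)) by apply: Cc_mull => //; exact: continuous_shift.
rewrite -(Rintegral_shift c C1) -RintegralB//.
- by apply: eq_Rintegral => x _; rewrite addrK mulrBl.
- exact: (Cc_integrable (Cc_shift c C1)).
- by apply: Cc_integrable; exact: Cc_mull.
Qed.

(** By the mean value theorem the increment is h times a derivative, and the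
    weak derivative moves that derivative from [psi] onto [g]. *)
Lemma increment_bound_smooth i z g psi (M h : K) : Cc z -> mu.-integrable setT (EFin \o g) ->
  weak_partial i z g -> test_function setT psi -> (forall x, `|psi x| <= M) -> 0 <= h ->
  `| \int[mu]_x ((z (x + h *: e_ i) - z x) * psi x) | <= h * (M * \int[mu]_x `|g x|).
Proof.
move=> zC ig wz tpsi psiM h0; have [sf _ _] := tpsi.
have cpsi := smooth_continuous sf.
have dpsi y : derivable psi y (e_ i) by exact: smooth_derivable.
have cdpsi : continuous (partial i psi) by apply: smooth_continuous; exact: smooth_partial.
pose F (s : K) := \int[mu]_x (z x * psi (x - s *: e_ i)).
have dF s := is_derive_convolution s zC cpsi dpsi cdpsi.
have dF' (s : K) : is_derive s 1 F (\int[mu]_x (g x * psi (x - s *: e_ i))).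
  apply: is_derive_eq (dF s) _.
  rewrite -[RHS]opprK -(wz _ (test_function_shift (- (s *: e_ i)) tpsi)).
  suff -> : (fun x => z x * partial i (fun y => psi (y - s *: e_ i)) x) =
    (fun x => z x * partial i psi (x - s *: e_ i)) by [].
  by apply/funext => x; rewrite (partial_shift i psi).
have [|c _ FE] := @MVT_segment K F _ 0 h h0 (fun s _ => dF' s).
  by apply: derivable_within_continuous => s _; have [] := dF' s.
rewrite increment_shift// (_ : _ - _ = F h - F 0); last by rewrite /F Rintegral_scale0.
rewrite FE subr0 normrM (ger0_norm h0) mulrC ler_wpM2l//.
apply: Rintegral_mul_bound => //.
by apply: continuous_measurable_rV; exact: continuous_shift.
Qed.

(** Both sides are continuous in [psi] for uniform convergence, so
    [smooth_approx] reduces this to [increment_bound_smooth]. *)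
Lemma increment_bound i z g psi (M h : K) : Cc z -> mu.-integrable setT (EFin \o g) ->
  weak_partial i z g -> Cc psi -> (forall x, `|psi x| <= M) -> 0 <= h ->
  `| \int[mu]_x ((z (x + h *: e_ i) - z x) * psi x) | <= h * (M * \int[mu]_x `|g x|).
Proof.
move=> zC ig wz psiC psiM h0.
pose D x := z (x + h *: e_ i) - z x.
have DC : Cc D by apply: Cc_sub => //; exact: Cc_shift.
pose A := \int[mu]_x `|D x|; pose G := \int[mu]_x `|g x|.
have A0 : 0 <= A by apply: Rintegral_ge0 => x _.
have G0 : 0 <= G by apply: Rintegral_ge0 => x _.
apply/ler_addgt0Pr => e e0.
(* replacing psi by psi' costs at most d * A on the left and h * G * d on the right *)
pose d := e / (A + h * G + 1).
have den0 : 0 < A + h * G + 1 by rewrite ltr_wpDl// addr_ge0// mulr_ge0.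
have d0 : 0 < d by rewrite divr_gt0.
have [psi' tpsi' psid] := smooth_approx psiC d0.
have psiM' x : `|psi' x| <= M + d.
  rewrite -(subrK (psi x) (psi' x)) (le_trans (ler_normD _ _))// addrC lerD//.
have := increment_bound_smooth zC ig wz tpsi' psiM' h0; rewrite -/G.
have cpsi' : continuous psi' by case: tpsi' => /smooth_continuous.
have cpsi : continuous psi by case: psiC.
have -> : \int[mu]_x ((z (x + h *: e_ i) - z x) * psi x) =
    \int[mu]_x (D x * psi' x) - \int[mu]_x (D x * (psi' x - psi x)).
  rewrite -RintegralB//.
  - by apply: eq_Rintegral => x _; rewrite /D; ring.
  - by apply: Cc_integrable; exact: Cc_mull.
  - apply: Cc_integrable; apply: Cc_mull => // x.
    by apply: continuousB; [exact: cpsi'|exact: cpsi].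
have HA : `| \int[mu]_x (D x * (psi' x - psi x)) | <= d * A.
  apply: Rintegral_mul_bound => //; first exact: Cc_integrable.
  by apply: continuous_measurable_rV => x; apply: continuousB; [exact: cpsi'|exact: cpsi].
move=> HB; rewrite (le_trans (ler_normB _ _))//.
rewrite (le_trans (lerD HB HA))//.
have -> : h * ((M + d) * G) + d * A = h * (M * G) + d * (A + h * G) by ring.
rewrite lerD2l /d mulrAC ler_pdivrMr// ler_pM2l//; lra.
Qed.

(** True for smooth [psi]; [increment_bound] controls the replacement of a
    continuous [psi] by a smooth one uniformly in h. *)
Lemma increment_cvg i z g psi : Cc z -> mu.-integrable setT (EFin \o g) ->
  weak_partial i z g -> Cc psi ->
  h^-1 * \int[mu]_x ((z (x + h *: e_ i) - z x) * psi x) @[h --> (0 : K)^'+] -->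
  \int[mu]_x (g x * psi x).
Proof.
move=> zC ig wz psiC; apply/cvgrPdist_le => e e0.
pose G := \int[mu]_x `|g x|.
have G0 : 0 <= G by apply: Rintegral_ge0 => x _.
pose d := e / (3 * (G + 1)).
have d0 : 0 < d by rewrite divr_gt0// mulr_gt0// ltr_wpDl.
have dG : d * G <= e / 3.
  have G1 : G + 1 != 0 by rewrite gt_eqF// ltr_wpDl.
  have -> : d * G = e / 3 * (G / (G + 1)) by rewrite /d; field.
  rewrite ler_piMr ?divr_ge0// ?(ltW e0)//.
  by apply: ltW; rewrite ltr_pdivrMr ?ltr_wpDl// mul1r ltrDl.
have [psi' tpsi' psid] := smooth_approx psiC d0.
have [sf _ _] := tpsi'.
have cpsi' := smooth_continuous sf.
have cpsi : continuous psi by case: psiC.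
have dpsi y : derivable psi' y (e_ i) by exact: smooth_derivable.
have cdpsi : continuous (partial i psi') by apply: smooth_continuous; exact: smooth_partial.
have := is_derive_convolution 0 zC cpsi' dpsi cdpsi.
rewrite Rintegral_scale0 (wz _ tpsi') opprK.
set L := \int[mu]_x (g x * psi' x); set F := fun s : K => _ => dF.
have FL := is_derive0_cvg dF.
have e30 : 0 < e / 3 by rewrite divr_gt0.
move/cvgrPdist_le : FL => /(_ _ e30) FL.
near=> h.
have h0 : 0 < h by near: h; exact: nbhs_right_gt.
have FLh : `|L - h^-1 * (F h - F 0)| <= e / 3 by near: h.
have DC : Cc (fun x => z (x + h *: e_ i) - z x) by apply: Cc_sub => //; exact: Cc_shift.
have pC : Cc (fun x => psi x - psi' x) by apply: Cc_sub => //; exact: test_functionT_Cc.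
have B1 := increment_bound zC ig wz pC (M := d) _ (ltW h0).
have {}B1 : `|h^-1 * \int[mu]_x ((z (x + h *: e_ i) - z x) * (psi x - psi' x))| <= e / 3.
  rewrite normrM normfV (gtr0_norm h0) mulrC ler_pdivrMr// mulrC.
  apply: le_trans (B1 _) _ => [x|]; first by rewrite distrC.
  by rewrite ler_wpM2l// ltW.
have B2 : `|\int[mu]_x (g x * (psi x - psi' x))| <= e / 3.
  apply: le_trans dG; apply: Rintegral_mul_bound => //.
    by apply: continuous_measurable_rV; case: pC.
  by move=> x _; rewrite distrC.
have E1 : \int[mu]_x (g x * psi x) = L + \int[mu]_x (g x * (psi x - psi' x)).
  have [B [_ HB]] := Cc_bounded pC.
  have [B' [_ HB']] := Cc_bounded (test_functionT_Cc tpsi').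
  rewrite -RintegralD//.
  - by apply: eq_Rintegral => x _; ring.
  - by apply: (integrable_mul_bounded (C := B')) => //; exact: continuous_measurable_rV.
  - apply: (integrable_mul_bounded (C := B)) => //; apply: continuous_measurable_rV; by case: pC.
have E2 : \int[mu]_x ((z (x + h *: e_ i) - z x) * psi x) =
    (F h - F 0) + \int[mu]_x ((z (x + h *: e_ i) - z x) * (psi x - psi' x)).
  have -> : F h - F 0 = \int[mu]_x ((z (x + h *: e_ i) - z x) * psi' x).
    by rewrite increment_shift// /F Rintegral_scale0.
  rewrite -RintegralD//.
  - by apply: eq_Rintegral => x _; ring.
  - by apply: Cc_integrable; exact: Cc_mull.
  - by apply: Cc_integrable; apply: Cc_mull => //; case: pC.
rewrite E1 E2 mulrDr.
set a := h^-1 * (F h - F 0) in FLh *; set b := h^-1 * _ in B1 *; set c := Rintegral _ _ _ in B2 *.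
have -> : L + c - (a + b) = (L - a) + (c - b) by ring.
rewrite (le_trans (ler_normD _ _))// (le_trans (lerD FLh (ler_normB _ _)))//.
lra.
Unshelve. all: by end_near.
Qed.

Definition pos (t : K) : K := Num.max t 0.

Lemma pos_ge0 t : 0 <= pos t.
Proof. by rewrite /pos le_max lexx orbT. Qed.

(** The square of the positive part is C^1 with 2-Lipschitz derivative. *)
Lemma pos_sqr_taylor a b : `|pos b ^+ 2 - pos a ^+ 2 - 2 * pos a * (b - a)| <= (b - a) ^+ 2.
Proof.
rewrite /pos /Num.max; case: ltP => b0; case: ltP => a0; rewrite ler_norml.
- by have ab := sqr_ge0 (b - a); apply/andP; split; lra.
- have b2 := sqr_ge0 b; have a2 := sqr_ge0 a; have ab : a * b <= 0 by nra.
  by apply/andP; split; lra.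
- have b2 := sqr_ge0 b; have a2 := sqr_ge0 a; have ab : a * b <= 0 by nra.
  by apply/andP; split; lra.
- by have ab := sqr_ge0 (b - a); apply/andP; split; lra.
Qed.

Lemma continuous_pos z : continuous z -> continuous (fun x => pos (z x)).
Proof.
move=> cz x; apply: (@continuous_comp _ _ _ z pos); first exact: cz.
apply: (@continuous_max _ _ id (cst 0)) => //; exact: cst_continuous.
Qed.

Lemma Cc_pos z : Cc z -> Cc (fun x => pos (z x)).
Proof.
move=> [cz [M zM]]; split; first exact: continuous_pos.
by exists M => x /zM ->; rewrite /pos maxxx.
Qed.

(** Chain rule for the square of the positive part. The difference quotient of
    P^2 is 2 P times that of z, up to a remainder bounded by the square of the
    increment of z. That remainder is again an increment of z integrated against
    a continuous function, namely the increment itself, which is uniformly small;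
    so [increment_bound] makes it negligible. *)
Lemma weak_partial_pos_sqr i z g phi : Cc z -> mu.-integrable setT (EFin \o g) ->
  weak_partial i z g -> continuous phi -> (forall y, derivable phi y (e_ i)) ->
  continuous (partial i phi) ->
  \int[mu]_x (pos (z x) ^+ 2 * partial i phi x) =
  - \int[mu]_x (g x * (2 * pos (z x) * phi x)).
Proof.
move=> zC ig wz cphi dphi cdphi.
pose V x := pos (z x) ^+ 2.
have pC := Cc_pos zC.
have VC : Cc V.
  by rewrite /V; under eq_fun do rewrite expr2; apply: Cc_mull => //; case: pC.
have [cz [M zM]] := zC.
pose Lam (h : K) := h^-1 * \int[mu]_x ((V (x + h *: e_ i) - V x) * phi x).
suff : Lam h @[h --> (0 : K)^'+] --> \int[mu]_x (g x * (2 * pos (z x) * phi x)).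
  move=> L1; pose F (s : K) := \int[mu]_x (V x * phi (x - s *: e_ i)).
  have := is_derive_convolution 0 VC cphi dphi cdphi.
  rewrite Rintegral_scale0 => /is_derive0_cvg; rewrite Rintegral_scale0 => L2.
  have L3 : Lam h @[h --> (0 : K)^'+] --> - (\int[mu]_x (V x * partial i phi x)).
    rewrite (_ : Lam = (fun h => h^-1 * (F h - \int[mu]_x (V x * phi x))))//.
    by apply/funext => h; rewrite /Lam increment_shift.
  by apply: oppr_inj; rewrite opprK; apply: esym; exact: (cvg_unique _ L1 L3).
have psiC : Cc (fun x => 2 * pos (z x) * phi x) by apply: Cc_mull => //; exact: Cc_scale.
have L3 := increment_cvg zC ig wz psiC.
have [C [C0 HC]] := continuous_bounded_box (M + 1) cphi.
pose G := \int[mu]_x `|g x|.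
have G0 : 0 <= G by apply: Rintegral_ge0 => x _.
apply/cvgrPdist_le => e e0.
have e20 : 0 < e / 2 by rewrite divr_gt0.
pose d := e / (2 * (C * G + 1)).
have den0 : 0 < C * G + 1 by rewrite ltr_wpDl// mulr_ge0.
have d0 : 0 < d by rewrite divr_gt0// mulr_gt0.
have dCG : d * C * G <= e / 2.
  have -> : d * C * G = e / 2 * (C * G / (C * G + 1)) by rewrite /d; field; rewrite gt_eqF.
  rewrite ler_piMr ?divr_ge0// ?(ltW e0)//.
  by rewrite ler_pdivrMr// mul1r lerDl.
have [d' d'0 zd] := Cc_uniform zC d0.
move/cvgrPdist_le : L3 => /(_ _ e20) L3.
near=> h.
have h0 : 0 < h by near: h; exact: nbhs_right_gt.
have hd : h < d' by near: h; exact: nbhs_right_lt.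
have h1 : h < 1 by near: h; exact: nbhs_right_lt.
have L3h : `|\int[mu]_x (g x * (2 * pos (z x) * phi x)) -
    h^-1 * \int[mu]_x ((z (x + h *: e_ i) - z x) * (2 * pos (z x) * phi x))| <= e / 2.
  by near: h.
pose D x := z (x + h *: e_ i) - z x.
(* S is the Taylor remainder *)
pose S x := V (x + h *: e_ i) - V x - 2 * pos (z x) * D x.
have DC : Cc D by apply: Cc_sub => //; exact: Cc_shift.
have SC : Cc S.
  apply: Cc_sub; first by apply: Cc_sub => //; exact: Cc_shift.
  by apply: Cc_mulr => //; case: (Cc_scale 2 pC).
have he : `|h *: e_ i| <= h by rewrite (le_trans (norm_scale_delta _ _))// gtr0_norm.
have Dd x : `|D x| <= d by apply: ltW; apply: zd; exact: le_lt_trans hd.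
have DM x : M + 1 < `|x| -> D x = 0.
  move=> xM; have : `|x| <= `|x + h *: e_ i| + `|h *: e_ i| by rewrite -{1}(addrK (h *: e_ i) x) (le_trans (ler_normB _ _)).
  move=> xh; have z1 : z (x + h *: e_ i) = 0 by apply: zM; lra.
  have z2 : z x = 0 by apply: zM; lra.
  by rewrite /D z1 z2 subrr.
have aphi : continuous (fun x => `|phi x|).
  by move=> x; apply: (@continuous_comp _ _ _ phi); [exact: cphi|exact: norm_continuous].
have DphiC : Cc (fun x => D x * `|phi x|) by exact: Cc_mull.
have Dphi_ub x : `|D x * `|phi x| | <= d * C.
  rewrite normrM normr_id; have [xM|/DM ->] := leP `|x| (M + 1).
    by rewrite ler_pM// HC.
  by rewrite normr0 mul0r mulr_ge0// ltW.
(* the remainder, bounded by an increment integrated against D * |phi| *)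
have BS : `|h^-1 * \int[mu]_x (S x * phi x)| <= e / 2.
  rewrite normrM normfV (gtr0_norm h0) mulrC ler_pdivrMr// mulrC.
  have := increment_bound zC ig wz DphiC Dphi_ub (ltW h0).
  rewrite -/G => H.
  apply: (@le_trans _ _ (h * (d * C * G))); last by rewrite ler_wpM2l// ltW.
  apply: le_trans H; apply: le_trans (ler_norm _).
  have iS : mu.-integrable setT (EFin \o (fun x => S x * phi x)).
    by apply: Cc_integrable; exact: Cc_mull.
  rewrite (le_trans (le_normr_Rintegral measurableT iS))//.
  apply: le_Rintegral => //.
  - exact: integrable_norm.
  - by apply: Cc_integrable; apply: Cc_mull => //; case: DphiC.
  - move=> x _; rewrite normrM mulrA -/(D x) -expr2 ler_wpM2r//.
    exact: pos_sqr_taylor.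
have -> : Lam h = h^-1 * \int[mu]_x (D x * (2 * pos (z x) * phi x)) + h^-1 * \int[mu]_x (S x * phi x).
  rewrite -mulrDr /Lam -RintegralD//.
  - by congr (_ * _); apply: eq_Rintegral => x _; rewrite /S; ring.
  - by apply: Cc_integrable; apply: Cc_mull => //; case: psiC.
  - by apply: Cc_integrable; exact: Cc_mull.
rewrite opprD addrA (le_trans (ler_normB _ _))// [e]splitr lerD//.
Unshelve. all: by end_near.
Qed.

End directional.

(** * The Euclidean norm and the convexity of its powers *)

Section euclidean.
Variables (K : realType) (n : nat).
Implicit Types (a b x y : 'rV[K]_n).

Lemma enorm_ge0 x : 0 <= enorm x.
Proof. exact: sqrtr_ge0. Qed.

Lemma enorm_sqr x : enorm x ^+ 2 = \sum_i x ord0 i ^+ 2.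
Proof. by rewrite sqr_sqrtr// sumr_ge0// => i _; exact: sqr_ge0. Qed.

Lemma enormZ (t : K) x : enorm (t *: x) = `|t| * enorm x.
Proof.
rewrite /enorm -sqrtr_sqr -sqrtrM ?sqr_ge0// mulr_sumr; congr Num.sqrt.
by apply: eq_bigr => i _; rewrite mxE exprMn.
Qed.

Lemma enormN x : enorm (- x) = enorm x.
Proof. by rewrite -scaleN1r enormZ normrN normr1 mul1r. Qed.

Lemma enorm_distC x y : enorm (x - y) = enorm (y - x).
Proof. by rewrite -enormN opprB. Qed.

Lemma enorm0_eq0 x : enorm x = 0 -> x = 0.
Proof.
move=> x0; apply/rowP => i; rewrite mxE; apply/eqP; rewrite -sqrf_eq0 eq_le sqr_ge0 andbT.
have : \sum_i x ord0 i ^+ 2 = 0 by rewrite -enorm_sqr x0 expr0n.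
by move=> <-; rewrite (bigD1 i)//= lerDl sumr_ge0// => j _; exact: sqr_ge0.
Qed.

(** Expand the squared norm of |b| a - |a| b. *)
Lemma cauchy_schwarz a b : \sum_i a ord0 i * b ord0 i <= enorm a * enorm b.
Proof.
have [/enorm0_eq0 ->|a0] := eqVneq (enorm a) 0.
  by rewrite big1 ?mulr_ge0 ?enorm_ge0// => i _; rewrite mxE mul0r.
have [/enorm0_eq0 ->|b0] := eqVneq (enorm b) 0.
  by rewrite big1 ?mulr_ge0 ?enorm_ge0// => i _; rewrite mxE mulr0.
have ab0 : 0 < enorm a * enorm b by rewrite mulr_gt0// lt_neqAle eq_sym ?a0 ?b0 enorm_ge0.
have : 0 <= \sum_i (enorm b * a ord0 i - enorm a * b ord0 i) ^+ 2.
  by apply: sumr_ge0 => i _; exact: sqr_ge0.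
have -> : \sum_i (enorm b * a ord0 i - enorm a * b ord0 i) ^+ 2 =
   2 * (enorm a * enorm b) * (enorm a * enorm b - \sum_i a ord0 i * b ord0 i).
  rewrite (eq_bigr (fun i => enorm b ^+ 2 * a ord0 i ^+ 2 + enorm a ^+ 2 * b ord0 i ^+ 2
    - 2 * (enorm a * enorm b) * (a ord0 i * b ord0 i))); last by move=> i _; ring.
  by rewrite sumrB big_split/= -!mulr_sumr -!enorm_sqr; ring.
by rewrite pmulr_rge0 ?subr_ge0// mulr_gt0.
Qed.

Lemma enorm_triangle a b : enorm (a + b) <= enorm a + enorm b.
Proof.
rewrite -(@ler_pXn2r _ 2) ?nnegrE ?enorm_ge0 ?addr_ge0 ?enorm_ge0//.
have -> : enorm (a + b) ^+ 2 = enorm a ^+ 2 + enorm b ^+ 2 + 2 * \sum_i a ord0 i * b ord0 i.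
  rewrite !enorm_sqr (eq_bigr (fun i => a ord0 i ^+ 2 + b ord0 i ^+ 2 + 2 * (a ord0 i * b ord0 i))).
    by rewrite !big_split/= -mulr_sumr.
  by move=> i _; rewrite mxE; ring.
have := cauchy_schwarz a b.
have -> : (enorm a + enorm b) ^+ 2 = enorm a ^+ 2 + enorm b ^+ 2 + 2 * (enorm a * enorm b) by ring.
by rewrite lerD2l ler_pM2l.
Qed.

Lemma norm_le_enorm x : `|x| <= enorm x.
Proof.
apply: norm_le_coord => [|i]; first exact: enorm_ge0.
rewrite -sqrtr_sqr ler_wsqrtr// (bigD1 i)//= lerDl sumr_ge0// => j _; exact: sqr_ge0.
Qed.

(** Tangent line inequality for the convex function s^p, in the form given by
    Young's inequality between s and r^(p-1). *)
Lemma powR_tangent (p s r : K) : 1 < p -> 0 <= s -> 0 <= r ->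
  r `^ p + p * r `^ (p - 1) * (s - r) <= s `^ p.
Proof.
move=> p1 s0 r0; have p0 : 0 < p by lra.
have pN0 : p != 0 by rewrite gt_eqF.
have p10 : 0 < p - 1 by lra.
have p1N0 : p - 1 != 0 by rewrite gt_eqF.
have := @conjugate_powR K s (r `^ (p - 1)) p (p / (p - 1)) s0 (powR_ge0 _ _) p0 (divr_gt0 p0 p10).
have -> : p^-1 + (p / (p - 1))^-1 = 1 by field; rewrite ?pN0 ?p1N0.
move=> /(_ erefl); rewrite -powRrM (_ : (p - 1) * (p / (p - 1)) = p); last by field; rewrite ?pN0 ?p1N0.
rewrite -(ler_pM2l p0).
have -> : p * (s `^ p / p + r `^ p / (p / (p - 1))) = s `^ p + (p - 1) * r `^ p.
  by field; rewrite ?pN0 ?p1N0.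
rewrite -(mulr_powRB1 r0 p0).
move: (r `^ (p - 1)) (s `^ p) => X S; lra.
Qed.

(** Convexity of |.|^p on the segment from [xi] to [zeta], followed by the
    tangent inequality at [zeta]: the change of energy density is controlled by
    the flux |zeta|^(p-2) zeta, which is explicit when [zeta] is the gradient of
    the barrier. *)
Lemma enorm_powR_tangent (p t : K) (xi zeta : 'rV[K]_n) : 1 < p -> 0 <= t <= 1 ->
  0 < enorm zeta ->
  enorm (xi + t *: (zeta - xi)) `^ p <= enorm xi `^ p +
   p * t * \sum_i (enorm zeta `^ (p - 2) * zeta ord0 i) * (zeta ord0 i - xi ord0 i).
Proof.
move=> p1 /andP[t0 t1] z0; have p0 : 0 < p by lra.
have le1 : enorm (xi + t *: (zeta - xi)) <= (1 - t) * enorm xi + t * enorm zeta.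
  have -> : xi + t *: (zeta - xi) = (1 - t) *: xi + t *: zeta.
    by rewrite scalerBr scalerBl scale1r; apply/rowP => i; rewrite !mxE; ring.
  by rewrite (le_trans (enorm_triangle _ _))// !enormZ !ger0_norm// subr_ge0.
have s0 := enorm_ge0 xi.
have m0 : 0 <= (1 - t) * enorm xi + t * enorm zeta by exact: le_trans (enorm_ge0 _) le1.
pose m := (1 - t) * enorm xi + t * enorm zeta; rewrite -/m in le1 m0.
apply: (@le_trans _ _ (m `^ p)).
  by apply: ge0_ler_powR; rewrite ?nnegrE ?enorm_ge0 ?(ltW p0).
apply: (@le_trans _ _ ((1 - t) * enorm xi `^ p + t * enorm zeta `^ p)).
  have := powR_tangent p1 s0 m0; have := powR_tangent p1 (ltW z0) m0.
  set d := p * m `^ (p - 1) => H1 H2.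
  have t'0 : 0 <= 1 - t by lra.
  have := lerD (ler_wpM2l t'0 H2) (ler_wpM2l t0 H1).
  suff -> : (1 - t) * (m `^ p + d * (enorm xi - m)) + t * (m `^ p + d * (enorm zeta - m)) = m `^ p by [].
  by rewrite /m; ring.
have -> : (1 - t) * enorm xi `^ p + t * enorm zeta `^ p = enorm xi `^ p + t * (enorm zeta `^ p - enorm xi `^ p) by ring.
rewrite lerD2l (mulrC p) -mulrA ler_wpM2l//.
have := powR_tangent p1 s0 (ltW z0).
have -> : enorm zeta `^ (p - 1) = enorm zeta `^ (p - 2) * enorm zeta.
  have p10 : 0 < p - 1 by lra.
  by rewrite -(mulr_powRB1 (ltW z0) p10) mulrC (_ : p - 1 - 1 = p - 2)//; ring.
have CS := cauchy_schwarz zeta xi.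
have -> : \sum_i enorm zeta `^ (p - 2) * zeta ord0 i * (zeta ord0 i - xi ord0 i) =
   enorm zeta `^ (p - 2) * (enorm zeta ^+ 2 - \sum_i zeta ord0 i * xi ord0 i).
  rewrite enorm_sqr -sumrB mulr_sumr; apply: eq_bigr => i _; ring.
move=> H.
have : 0 <= p * enorm zeta `^ (p - 2) * (enorm zeta * enorm xi - \sum_i zeta ord0 i * xi ord0 i).
  by rewrite mulr_ge0 ?subr_ge0// mulr_ge0 ?powR_ge0// ltW.
lra.
Qed.

End euclidean.

(** * The barrier and its p-flux *)

Section barrier.
Variables (K : realType) (n : nat) (y : 'rV[K]_n) (r0 : K).
Hypothesis r00 : 0 < r0.
Implicit Types (x : 'rV[K]_n) (e : K).
Notation e_ i := (delta_mx (ord0 : 'I_1) i : 'rV[K]_n).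

Definition sqdist x : K := \sum_i (x ord0 i - y ord0 i) ^+ 2.

Lemma sqdist_enorm x : sqdist x = enorm (x - y) ^+ 2.
Proof. by rewrite enorm_sqr; apply: eq_bigr => i _; rewrite !mxE. Qed.

Lemma sqdist_ge0 x : 0 <= sqdist x.
Proof. by rewrite sqdist_enorm sqr_ge0. Qed.

(** Equal to the squared distance outside the ball of radius [r0], but smooth
    and positive everywhere; thus its real powers are smooth functions on the
    whole space. *)
Definition regdist x : K := sqdist x + flat 0 (r0 ^+ 2 - sqdist x).

Lemma regdist_gt0 x : 0 < regdist x.
Proof.
rewrite /regdist; have [x0|x0] := ltP (sqdist x) (r0 ^+ 2).
  rewrite ltr_wpDl ?sqdist_ge0// /flat subr_gt0 x0 expr0 mul1r expR_gt0//.
by rewrite ltr_pwDl ?flat_ge0//; apply: lt_le_trans x0; rewrite exprn_gt0.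
Qed.

Lemma regdistE x : r0 ^+ 2 <= sqdist x -> regdist x = sqdist x.
Proof. by move=> x0; rewrite /regdist flat_le0 ?addr0// subr_le0. Qed.

Lemma Ck_sqdist m : Ck m sqdist.
Proof.
apply: Ck_sum => i.
have C : Ck m (fun x => x ord0 i - y ord0 i).
  by apply: Ck_add; [exact: Ck_coord|exact: Ck_cst].
by apply: eq_Ck (Ck_mul C C) => x; rewrite expr2.
Qed.

Lemma Ck_regdist m : Ck m regdist.
Proof.
apply: Ck_add; first exact: Ck_sqdist.
apply: (Ck_flat 0 (g := fun x => r0 ^+ 2 - sqdist x)).
by apply: Ck_add; [exact: Ck_cst|apply: Ck_opp; exact: Ck_sqdist].
Qed.

Lemma is_derive_sqdist i x : is_derive x (e_ i) sqdist (2 * (x ord0 i - y ord0 i)).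
Proof.
have D j : is_derive x (e_ i) (fun x => (x ord0 j - y ord0 j) ^+ 2)
    (2 * (x ord0 j - y ord0 j) * (i == j)%:R).
  have D1 : is_derive x (e_ i) (fun x : 'rV[K]_n => x ord0 j - y ord0 j) ((i == j)%:R).
    have := is_deriveB (is_derive_coord x (e_ i) j) (is_derive_cst (y ord0 j) x (e_ i)).
    by rewrite subr0 mxE eqxx/= eq_sym.
  have := is_deriveX 2 D1; rewrite exprfctE => /is_derive_eq; apply.
  by rewrite /GRing.scale/= expr1.
have := is_derive_sum D.
have -> : \sum_(j < n) (fun x : 'rV[K]_n => (x ord0 j - y ord0 j) ^+ 2) = sqdist.
  by apply/funext => z; rewrite fct_sumE.
move/is_derive_eq; apply.
rewrite (bigD1 i)//= eqxx mulr1 big1 ?addr0// => j ji.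
by rewrite eq_sym (negbTE ji) mulr0.
Qed.

Lemma is_derive_regdist i x : r0 ^+ 2 <= sqdist x ->
  is_derive x (e_ i) regdist (2 * (x ord0 i - y ord0 i)).
Proof.
move=> x0.
have D1 : is_derive x (e_ i) (fun x => r0 ^+ 2 - sqdist x) (0 - 2 * (x ord0 i - y ord0 i)).
  exact: (is_deriveB (is_derive_cst _ _ _) (is_derive_sqdist i x)).
have := is_derive_comp (is_derive_flat 0 _) D1.
rewrite !flat_le0 ?subr_le0// mulr0 addr0 mul0r => D2.
by have := is_deriveD (is_derive_sqdist i x) D2; rewrite addr0.
Qed.

Lemma Ck_powR m (f : 'rV[K]_n -> K) e : (forall x, 0 < f x) -> Ck m f ->
  Ck m (fun x => f x `^ e).
Proof.
move=> f0; elim: m e => [|m IH] e.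
  move=> cf x; apply: (@continuous_comp _ _ _ f (fun t => t `^ e)); first exact: cf.
  apply: differentiable_continuous; apply/derivable1_diffP.
  by have [] := is_derive1_powR e (f0 x).
move=> Cf; have [cf df pf] := Cf.
have D i x : is_derive x (e_ i) (fun x => f x `^ e) (e * f x `^ (e - 1) * partial i f x).
  by apply: (is_derive_comp (F := fun t => t `^ e)); [exact: is_derive1_powR|apply/derivableP; exact: df].
split.
- move=> x; apply: (@continuous_comp _ _ _ f (fun t => t `^ e)); first exact: cf.
  apply: differentiable_continuous; apply/derivable1_diffP.
  by have [] := is_derive1_powR e (f0 x).
- by move=> i x; have [] := D i x.
- move=> i.
  apply: eq_Ck (Ck_mul (Ck_mul (Ck_cst n m e) (IH (e - 1) (CkW Cf))) (pf i)) => x.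
  by rewrite /partial; have [_ ->] := D i x.
Qed.

Lemma is_derive_regdist_powR i x e : r0 ^+ 2 <= sqdist x ->
  is_derive x (e_ i) (fun x => regdist x `^ e)
   (e * sqdist x `^ (e - 1) * (2 * (x ord0 i - y ord0 i))).
Proof.
move=> x0; have := is_derive_comp (is_derive1_powR e (regdist_gt0 x)) (is_derive_regdist i x0).
by rewrite {1}regdistE.
Qed.

Variables A B ga q : K.

Definition barrier x : K := A - B * regdist x `^ (ga / 2).

(** Up to a positive constant |grad w|^(p-2) grad w for w the barrier, when
    q = (1 - ga) (p - 1) + 1; see [flux_barrier]. *)
Definition flux (i : 'I_n) x : K := - (regdist x `^ (- q / 2) * (x ord0 i - y ord0 i)).

Lemma Ck_barrier m : Ck m barrier.
Proof.
apply: Ck_add; first exact: Ck_cst.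
apply: Ck_opp; apply: Ck_mul; first exact: Ck_cst.
by apply: Ck_powR; [exact: regdist_gt0|exact: Ck_regdist].
Qed.

Lemma Ck_flux m i : Ck m (flux i).
Proof.
apply: Ck_opp; apply: Ck_mul.
  by apply: Ck_powR; [exact: regdist_gt0|exact: Ck_regdist].
by apply: Ck_add; [exact: Ck_coord|exact: Ck_cst].
Qed.

Lemma partial_barrier i x : r0 ^+ 2 <= sqdist x ->
  partial i barrier x = - (B * ga * sqdist x `^ (ga / 2 - 1)) * (x ord0 i - y ord0 i).
Proof.
move=> x0.
have := is_deriveB (is_derive_cst A x (e_ i)) (is_deriveZ B (is_derive_regdist_powR i (ga / 2) x0)).
move=> [_]; rewrite -/(partial i _ x) => ->.
by rewrite /GRing.scale/=; field.
Qed.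

Lemma partial_flux i x : r0 ^+ 2 <= sqdist x ->
  partial i (flux i) x = q * sqdist x `^ (- q / 2 - 1) * (x ord0 i - y ord0 i) ^+ 2
    - sqdist x `^ (- q / 2).
Proof.
move=> x0.
have D1 : is_derive x (e_ i) (fun x : 'rV[K]_n => x ord0 i - y ord0 i) 1.
  have := is_deriveB (is_derive_coord x (e_ i) i) (is_derive_cst (y ord0 i) x (e_ i)).
  by rewrite subr0 mxE !eqxx.
have := is_deriveN (is_deriveM (is_derive_regdist_powR i (- q / 2) x0) D1).
move=> [_]; rewrite -/(partial i _ x) => ->.
by rewrite /GRing.scale/= regdistE//; field.
Qed.

(** The field -(x - y) |x - y|^(-q) has divergence (q - n) |x - y|^(-q):
    positive exactly when q > n. *)
Lemma divergence_flux x : r0 ^+ 2 <= sqdist x ->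
  \sum_i partial i (flux i) x = (q - n%:R) * sqdist x `^ (- q / 2).
Proof.
move=> x0; have sq0 : 0 < sqdist x by apply: lt_le_trans x0; rewrite exprn_gt0.
under eq_bigr => i _ do rewrite partial_flux//.
rewrite sumrB -mulr_sumr -/(sqdist x) sumr_const card_ord -[X in _ - X]mulr_natl mulrBl; congr (_ - _).
rewrite -mulrA; congr (_ * _).
by rewrite -{2}(powRr1 (ltW sq0)) -powRD ?(gt_eqF sq0) ?implybT// subrK.
Qed.

Lemma barrier_le_A x : 0 <= B -> barrier x <= A.
Proof. by move=> B0; rewrite gerBl mulr_ge0 ?powR_ge0. Qed.

Lemma barrierE x : r0 ^+ 2 <= sqdist x -> barrier x = A - B * enorm (x - y) `^ ga.
Proof.
move=> x0; rewrite /barrier regdistE// sqdist_enorm -powR_mulrn ?enorm_ge0//.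
by rewrite -powRrM; congr (_ - _ * _ `^ _); field.
Qed.

End barrier.

Section flux_barrier.
Variables (K : realType) (n : nat) (y : 'rV[K]_n) (r0 A B ga p : K).
Hypotheses (r00 : 0 < r0) (B0 : 0 < B) (ga0 : 0 < ga).
Implicit Types (x : 'rV[K]_n).

Definition grad_barrier x : 'rV[K]_n := \row_i partial i (barrier y r0 A B ga) x.

Lemma grad_barrierE x : r0 ^+ 2 <= sqdist y x ->
  grad_barrier x = - (B * ga * sqdist y x `^ (ga / 2 - 1)) *: (x - y).
Proof. by move=> x0; apply/rowP => i; rewrite !mxE partial_barrier. Qed.

Lemma enorm_grad_barrier x : r0 ^+ 2 <= sqdist y x ->
  enorm (grad_barrier x) = B * ga * sqdist y x `^ ((ga - 1) / 2).
Proof.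
move=> x0; have sq0 : 0 < sqdist y x by apply: lt_le_trans x0; rewrite exprn_gt0.
rewrite grad_barrierE// enormZ normrN ger0_norm; last by rewrite !mulr_ge0 ?powR_ge0 ?ltW.
have -> : enorm (x - y) = sqdist y x `^ 2^-1.
  by rewrite powR12_sqrt ?sqdist_ge0// sqdist_enorm sqrtr_sqr ger0_norm ?enorm_ge0.
rewrite -!mulrA -powRD; last by rewrite (gt_eqF sq0) implybT.
by congr (_ * (_ * _ `^ _)); field.
Qed.

Lemma flux_barrier i x : r0 ^+ 2 <= sqdist y x ->
  enorm (grad_barrier x) `^ (p - 2) * grad_barrier x ord0 i =
  ((B * ga) `^ (p - 2) * (B * ga)) * flux y r0 ((1 - ga) * (p - 1) + 1) i x.
Proof.
move=> x0; have sq0 : 0 < sqdist y x by apply: lt_le_trans x0; rewrite exprn_gt0.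
have Bga : 0 < B * ga by rewrite mulr_gt0.
rewrite enorm_grad_barrier// grad_barrierE// !mxE /flux regdistE//.
rewrite powRM ?powR_ge0 ?(ltW Bga)// -powRrM.
have -> : - ((1 - ga) * (p - 1) + 1) / 2 = (ga - 1) / 2 * (p - 2) + (ga / 2 - 1) by field.
rewrite (@powRD _ (sqdist y x) ((ga - 1) / 2 * (p - 2))); last by rewrite (gt_eqF sq0) implybT.
move: ((B * ga) `^ _) (sqdist y x `^ ((ga - 1) / 2 * (p - 2))) (sqdist y x `^ (ga / 2 - 1)) => a b c.
by ring.
Qed.

End flux_barrier.

(** * Integration by parts and nonnegative integrands *)

Section weak_partial_calculus.
Variables (K : realType) (n : nat).
Notation mu := (lebesgue_rV n).
Implicit Types (z g f phi psi : 'rV[K]_n -> K).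
Notation e_ i := (delta_mx (ord0 : 'I_1) i : 'rV[K]_n).

(** Differentiate in s at 0 the identity between the integrals of
    f(x) phi(x - s e) and of f(x + s e) phi(x). *)
Lemma weak_partial_C1 i f : Cc f -> (forall x, derivable f x (e_ i)) ->
  continuous (partial i f) -> weak_partial i f (partial i f).
Proof.
move=> fC df cdf phi tphi; have [sphi _ _] := tphi.
have phiC := test_functionT_Cc tphi.
have cphi := smooth_continuous sphi.
have dphi x : derivable phi x (e_ i) by exact: smooth_derivable.
have cdphi : continuous (partial i phi) by apply: smooth_continuous; exact: smooth_partial.
have cf : continuous f by case: fC.
have := is_derive_convolution 0 fC cphi dphi cdphi; rewrite Rintegral_scale0.
set F := fun s => _ => DF.
have := is_derive_convolution 0 phiC cf df cdf; rewrite Rintegral_scale0.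
set G := fun s => _ => DG.
have FG : F = G \o -%R.
  apply/funext => s; rewrite /F /G /=.
  have C1 : Cc (fun x => f x * phi (x - s *: e_ i)) by apply: (Cc_mull fC); exact: continuous_shift.
  rewrite -(Rintegral_shift (s *: e_ i) C1); apply: eq_Rintegral => x _.
  by rewrite addrK scaleNr opprK mulrC.
have DN : is_derive (0 : K) 1 (-%R : K -> K) (- 1).
  exact: (is_deriveN (is_derive_id (0 : K) (1 : K))).
have : is_derive (0 : K) 1 F (- (\int[mu]_x (phi x * partial i f x)) * - 1).
  by rewrite FG; apply: is_derive1_comp DN; rewrite oppr0.
move=> [_]; have [_ ->] := DF => E.
apply: oppr_inj; rewrite opprK; transitivity (- (\int[mu]_x (phi x * partial i f x)) * - 1) => //.
by rewrite mulrN1 opprK; apply: eq_Rintegral => x _; rewrite mulrC.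
Qed.

Lemma weak_partialB i z1 z2 g1 g2 : Cc z1 -> Cc z2 ->
  mu.-integrable setT (EFin \o g1) -> mu.-integrable setT (EFin \o g2) ->
  weak_partial i z1 g1 -> weak_partial i z2 g2 ->
  weak_partial i (fun x => z1 x - z2 x) (fun x => g1 x - g2 x).
Proof.
move=> C1 C2 i1 i2 w1 w2 phi tphi; have [sphi _ _] := tphi.
have cphi := smooth_continuous sphi.
have cdphi : continuous (partial i phi) by apply: smooth_continuous; exact: smooth_partial.
have [b [b0 phib]] := Cc_bounded (test_functionT_Cc tphi).
under eq_Rintegral do rewrite mulrBl.
under [in RHS]eq_Rintegral do rewrite mulrBl.
rewrite RintegralB//; first last.
- by apply: Cc_integrable; exact: Cc_mull.
- by apply: Cc_integrable; exact: Cc_mull.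
rewrite RintegralB//; first last.
- by apply: (integrable_mul_bounded (C := b)) => //; exact: continuous_measurable_rV.
- by apply: (integrable_mul_bounded (C := b)) => //; exact: continuous_measurable_rV.
by rewrite (w1 _ tphi) (w2 _ tphi); ring.
Qed.

(** A continuous function positive at a point is bounded below on a box around
    it, and boxes have positive measure. *)
Lemma Cc_Rintegral_le0 f : Cc f -> (forall x, 0 <= f x) ->
  \int[mu]_x f x <= 0 -> forall x, f x = 0.
Proof.
move=> fC f0 If x; apply/eqP; rewrite eq_le f0 andbT leNgt; apply/negP => fx0.
have [d d0 fd] := Cc_uniform fC (divr_gt0 fx0 (ltr0n _ 2)).
pose A (i : 'I_n) : set (measurableTypeR K) := `]x ord0 i - d / 2, x ord0 i + d / 2[%classic.
pose box := [set z : 'rV[K]_n | forall i, A i (z ord0 i)].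
have mbox : measurable box.
  rewrite (_ : box = \bigcap_(i in [set: 'I_n])
     ((fun x : 'rV[K]_n => x ord0 i : measurableTypeR K) @^-1` A i)).
    apply: fin_bigcap_measurable => // i _.
    rewrite -[X in measurable X]setTI; apply: measurable_rV_coord => //.
    exact: measurable_itv.
  by apply/seteqP; split=> [z xA i _|z xA i]; exact: xA.
have mubox : mu box = (\prod_(i < n) d)%:E.
  rewrite /box lebesgue_rV_box => [|i]; last exact: measurable_itv.
  rewrite (big_morph (@EFin K) (@EFinM K) erefl); apply: eq_bigr => i _.
  by rewrite /A lebesgue_measure_itv/= lte_fin ifT; [rewrite -EFinD; congr EFin; field|lra].
have boxfin : (mu box < +oo)%E by rewrite mubox ltry.
have bd0 : 0 < \prod_(i < n) d by apply: prodr_gt0.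
have : \int[mu]_(z in box) (f x / 2) <= \int[mu]_x f x.
  rewrite Rintegral_mkcond; apply: le_Rintegral => //.
  - rewrite (_ : _ \o _ = (EFin \o cst (f x / 2)) \_ box); last first.
      by apply/funext => z; rewrite /= !patchE; case: ifP.
    apply: (integrable_mkcond _ mbox).1.
    exact: (integrable_cst_fin _ mbox boxfin).
  - exact: Cc_integrable.
  - move=> z _; rewrite patchE; case: ifPn => [|_]; last exact: f0.
    rewrite inE => /= zA; have := fd x (z - x).
    rewrite (addrC x) subrK => H.
    have : `|z - x| < d.
      apply: (@le_lt_trans _ _ (d / 2)); last by lra.
      apply: norm_le_coord => [|i]; first lra.
      have := zA i; rewrite /A/= in_itv/= !mxE => /andP[h1 h2].
      by rewrite ler_norml; apply/andP; split; lra.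
    by move/H; rewrite ltr_norml; lra.
have -> : \int[mu]_(z in box) (f x / 2) = f x / 2 * \prod_(i < n) d.
  by rewrite Rintegral_cst//; exact: (congr1 (fun t => f x / 2 * fine t) mubox).
have : 0 < f x / 2 * \prod_(i < n) d by rewrite mulr_gt0// divr_gt0.
lra.
Qed.

End weak_partial_calculus.

(** * Membership in Lebesgue spaces *)

Section Lfun_rV.
Context d (T : measurableType d) (K : realType).
Variable mu : {measure set T -> \bar K}.
Variables (p : K).
Hypothesis p1 : 1 <= p.
Let p0 : 0 <= p := le_trans ler01 p1.
Implicit Types (f h : T -> K).

Lemma Lfun_measurable f : f \in Lfun mu p%:E -> measurable_fun setT f.
Proof. by rewrite inE => /andP[]; rewrite inE. Qed.

Lemma integrable_Lfun f : measurable_fun setT f ->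
  mu.-integrable setT (fun x => (`|f x| `^ p)%:E) -> f \in Lfun mu p%:E.
Proof.
move=> mf /integrableP[_ If].
rewrite inE; apply/andP; split; first by rewrite inE.
rewrite inE /= /finite_norm unlock /=; apply: poweR_lty.
apply: le_lt_trans If; apply: ge0_le_integral => //.
- apply/measurable_EFinP; apply: (measurableT_comp (measurable_powR _)).
  exact: measurableT_comp.
- apply: measurableT_comp => //; apply/measurable_EFinP; apply: (measurableT_comp (measurable_powR _)).
  exact: measurableT_comp.
- by move=> x _; rewrite /= lee_fin ler_norm.
Qed.

Lemma Lfun_le f h : measurable_fun setT f -> h \in Lfun mu p%:E ->
  (forall x, `|f x| <= `|h x|) -> f \in Lfun mu p%:E.
Proof.
move=> mf Lh fh; apply: integrable_Lfun => //.
apply: (le_integrable measurableT _ _ (Lfun_integrable p1 Lh)).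
  apply/measurable_EFinP; apply: (measurableT_comp (measurable_powR _)).
  exact: measurableT_comp.
move=> x _ /=; rewrite lee_fin !(ger0_norm (powR_ge0 _ _)).
by apply: ge0_ler_powR; rewrite ?nnegrE ?normr_ge0.
Qed.

Lemma Lfun_integrable_support f (D : set T) : measurable D -> (mu D < +oo)%E ->
  (forall x, ~ D x -> f x = 0) -> f \in Lfun mu p%:E -> mu.-integrable setT (EFin \o f).
Proof.
move=> mD Dfin f0 Lf.
have i1 : mu.-integrable setT (EFin \o (cst (1:K) \_ D)).
  rewrite (_ : _ \o _ = (EFin \o cst (1 : K)) \_ D); last first.
    by apply/funext => x; rewrite /= !patchE; case: ifP.
  apply: (integrable_mkcond _ mD).1; exact: integrable_cst_fin.
have i2 := integrableD measurableT i1 (Lfun_integrable p1 Lf).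
apply: (le_integrable measurableT _ _ i2).
  by apply/measurable_EFinP; exact: Lfun_measurable.
move=> x _ /=; rewrite lee_fin patchE; case: ifPn => [_|].
  rewrite [leRHS]ger0_norm ?addr_ge0 ?powR_ge0//=.
  have [fx1|fx1] := leP `|f x| 1; first by rewrite (le_trans fx1)// lerDl powR_ge0.
  by rewrite (le_trans (le1r_powR (ltW fx1) p1))// lerDr.
by rewrite notin_setE => /f0 ->; rewrite normr0.
Qed.

Lemma Lfun_bounded f (D : set T) (C : K) : measurable D -> (mu D < +oo)%E ->
  (forall x, ~ D x -> f x = 0) -> measurable_fun setT f -> (forall x, `|f x| <= C) ->
  f \in Lfun mu p%:E.
Proof.
move=> mD Dfin f0 mf fC; apply: integrable_Lfun => //.
have C0 (x : T) : 0 <= C by exact: le_trans (normr_ge0 _) (fC x).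
have i1 : mu.-integrable setT (EFin \o (cst (C `^ p) \_ D)).
  rewrite (_ : _ \o _ = (EFin \o cst (C `^ p)) \_ D); last first.
    by apply/funext => x; rewrite /= !patchE; case: ifP.
  apply: (integrable_mkcond _ mD).1; exact: integrable_cst_fin.
apply: (le_integrable measurableT _ _ i1).
  apply/measurable_EFinP; apply: (measurableT_comp (measurable_powR _)).
  exact: measurableT_comp.
move=> x _ /=; rewrite lee_fin patchE; case: ifPn => [_|].
  rewrite !(ger0_norm (powR_ge0 _ _)); by apply: ge0_ler_powR; rewrite ?nnegrE ?normr_ge0 ?(C0 x).
by rewrite notin_setE => /f0 ->; rewrite normr0 powR0 ?normr0// gt_eqF// (lt_le_trans ltr01 p1).
Qed.

End Lfun_rV.

(** * Localization by a radial cutoff *)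

Section cutoff.
Variables (K : realType) (n : nat) (y : 'rV[K]_n) (rho1 rho : K).
Hypotheses (rho10 : 0 < rho1) (rho1rho : rho1 < rho).
Notation mu := (lebesgue_rV n).
Implicit Types (x : 'rV[K]_n) (f u phi : 'rV[K]_n -> K) (Omega : set 'rV[K]_n).
Notation e_ i := (delta_mx (ord0 : 'I_1) i : 'rV[K]_n).

Lemma sqdist_le (t : K) x : 0 <= t -> (sqdist y x <= t ^+ 2) = (enorm (x - y) <= t).
Proof. by move=> t0; rewrite sqdist_enorm ler_pXn2r ?nnegrE ?enorm_ge0. Qed.

Lemma sqdist_lt (t : K) x : 0 <= t -> (sqdist y x < t ^+ 2) = (enorm (x - y) < t).
Proof. by move=> t0; rewrite sqdist_enorm ltr_pXn2r ?nnegrE ?enorm_ge0. Qed.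

(** 1 on the ball of radius [rho1] around [y], 0 outside that of radius [rho]. *)
Definition cutoff x : K := step ((rho ^+ 2 - sqdist y x) / (rho ^+ 2 - rho1 ^+ 2)).

Let den0 : 0 < rho ^+ 2 - rho1 ^+ 2.
Proof. by rewrite subr_gt0 ltr_pXn2r ?nnegrE ?ltW// (lt_trans rho10). Qed.

Let rho0 : 0 < rho. Proof. exact: lt_trans rho10 rho1rho. Qed.

Lemma Ck_cutoff m : Ck m cutoff.
Proof.
apply: Ck_step; apply: Ck_mul; last exact: Ck_cst.
apply: Ck_add; first exact: Ck_cst.
by apply: Ck_opp; exact: Ck_sqdist.
Qed.

Lemma smooth_cutoff : smooth cutoff.
Proof. by apply/smoothP => m; exact: Ck_cutoff. Qed.

Lemma cutoff_eq1 x : sqdist y x <= rho1 ^+ 2 -> cutoff x = 1.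
Proof. by move=> h; apply: step_ge1; rewrite ler_pdivlMr// mul1r lerD2l lerN2. Qed.

Lemma cutoff_eq0 x : rho ^+ 2 <= sqdist y x -> cutoff x = 0.
Proof. by move=> h; apply: step_le0; rewrite pmulr_lle0 ?invr_gt0// subr_le0. Qed.

Lemma cutoff_ge0 x : 0 <= cutoff x.
Proof. exact: step_ge0. Qed.

Let csq : continuous (sqdist y). Proof. exact: (Ck_continuous (Ck_sqdist y 0)). Qed.

Lemma near_sqdist_lt (t : K) x : sqdist y x < t -> \forall z \near x, sqdist y z < t.
Proof.
move=> h; have /cvgrPdist_lt/(_ (t - sqdist y x)) := @csq x.
rewrite subr_gt0 => /(_ h); apply: filterS => z; rewrite ltr_norml => /andP[]; lra.
Qed.

Lemma near_sqdist_gt (t : K) x : t < sqdist y x -> \forall z \near x, t < sqdist y z.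
Proof.
move=> h; have /cvgrPdist_lt/(_ (sqdist y x - t)) := @csq x.
rewrite subr_gt0 => /(_ h); apply: filterS => z; rewrite ltr_norml => /andP[]; lra.
Qed.

Lemma partial_cutoff_eq0 i x : sqdist y x < rho1 ^+ 2 -> partial i cutoff x = 0.
Proof.
move=> h; apply: (@partial_near_cst _ _ _ _ 1); near=> z; apply: cutoff_eq1; apply: ltW.
near: z; exact: near_sqdist_lt.
Unshelve. all: by end_near.
Qed.

Lemma partial_cutoff_out i x : rho ^+ 2 < sqdist y x -> partial i cutoff x = 0.
Proof.
move=> h; apply: (@partial_near_cst _ _ _ _ 0); near=> z; apply: cutoff_eq0; apply: ltW.
near: z; exact: near_sqdist_gt.
Unshelve. all: by end_near.
Qed.

Lemma norm_gt_sqdist x : `|y| + rho < `|x| -> rho ^+ 2 < sqdist y x.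
Proof.
move=> xM; rewrite ltNge sqdist_le ?(ltW rho0)//; apply/negP => xy.
have : `|x| <= `|x - y| + `|y| by rewrite -{1}(subrK y x) ler_normD.
have := norm_le_enorm (x - y); lra.
Qed.

Variable Omega : set 'rV[K]_n.
Hypothesis ballO : forall x, enorm (x - y) <= rho -> Omega x.

Let ballO' x : sqdist y x <= rho ^+ 2 -> Omega x.
Proof. by rewrite sqdist_le ?(ltW rho0)//; exact: ballO. Qed.

Lemma notin_sqdist x : ~ Omega x -> rho ^+ 2 < sqdist y x.
Proof. by move=> nOx; rewrite ltNge; apply/negP => /ballO'. Qed.

Variable u : 'rV[K]_n -> K.
Hypothesis cu : forall x, Omega x -> {for x, continuous u}.

Lemma Cc_local f : continuous f -> (forall x, rho ^+ 2 < sqdist y x -> f x = 0) ->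
  Cc (fun x => f x * u x).
Proof.
move=> cf f0; split; last first.
  by exists (`|y| + rho) => x /norm_gt_sqdist/f0 ->; rewrite mul0r.
move=> x; have [xr|xr] := leP (sqdist y x) (rho ^+ 2).
  by apply: continuousM; [exact: cf|apply: cu; exact: ballO'].
have near0 : \forall z \near x, 0 = f z * u z.
  near=> z; rewrite f0 ?mul0r//; near: z; exact: near_sqdist_gt.
rewrite /continuous_at f0// mul0r.
by apply: (cvg_trans (near_eq_cvg near0)); exact: cvg_cst.
Unshelve. all: by end_near.
Qed.

Lemma test_function_cutoff phi : smooth phi -> test_function Omega (fun x => cutoff x * phi x).
Proof.
move=> sphi.
have f0 x : rho ^+ 2 < sqdist y x -> cutoff x * phi x = 0.
  by move=> /ltW/cutoff_eq0 ->; rewrite mul0r.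
split.
- by apply/smoothP => m; apply: Ck_mul; [exact: Ck_cutoff|exact: (smoothP phi).1].
- by apply: (@vanish_compact_closure _ _ _ (`|y| + rho)) => x /norm_gt_sqdist/f0.
- have cl : closed [set x : 'rV[K]_n | sqdist y x <= rho ^+ 2].
    rewrite (_ : [set _ | _] = (sqdist y) @^-1` [set t : K | t <= rho ^+ 2])//.
    by apply: closed_comp => [x _|]; [exact: csq|exact: closed_le].
  apply: (@subset_trans _ [set x : 'rV[K]_n | sqdist y x <= rho ^+ 2]); last first.
    by move=> x /ballO'.
  rewrite [X in _ `<=` X](closure_id _).1//; apply: closure_subset => x /=.
  by apply: contraNT; rewrite -ltNge => /f0 ->.
Qed.

Variable Du : 'rV[K]_n -> 'rV[K]_n.
Hypothesis wu : weak_gradient Omega u Du.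
Hypothesis iDu : forall i, mu.-integrable setT (EFin \o ((fun x => Du x ord0 i) \_ Omega)).

(** The weak gradient of [cutoff] times [u]. *)
Definition cutoff_grad i x := cutoff x * Du x ord0 i + partial i cutoff x * u x.

Let ccut : continuous cutoff. Proof. exact: smooth_continuous smooth_cutoff. Qed.
Let cpcut i : continuous (partial i cutoff).
Proof. by apply: smooth_continuous; apply: smooth_partial; exact: smooth_cutoff. Qed.

Lemma Cc_cutoff_u : Cc (fun x => cutoff x * u x).
Proof. by apply: Cc_local => // x /ltW; exact: cutoff_eq0. Qed.

Lemma Cc_pcutoff_u i : Cc (fun x => partial i cutoff x * u x).
Proof. by apply: Cc_local => // x; exact: partial_cutoff_out. Qed.

Lemma Cc_cutoff : Cc cutoff.
Proof. by split => //; exists (`|y| + rho) => x /norm_gt_sqdist/ltW; exact: cutoff_eq0. Qed.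

Lemma integrable_local_Du i f : Cc f -> (forall x, ~ Omega x -> f x = 0) ->
  mu.-integrable setT (EFin \o (fun x => f x * Du x ord0 i)).
Proof.
move=> fC f0; have [b [_ fb]] := Cc_bounded fC.
have mf : measurable_fun setT f by apply: continuous_measurable_rV; case: fC.
have := integrable_mul_bounded measurableT (iDu i) mf (fun x _ => fb x).
congr (_.-integrable _ _); apply/funext => x /=; congr (_%:E); rewrite patchE.
by case: ifPn => [_|]; [rewrite mulrC|rewrite notin_setE => /f0 ->; rewrite mulr0 mul0r].
Qed.

Lemma integrable_cutoff_Du i : mu.-integrable setT (EFin \o (fun x => cutoff x * Du x ord0 i)).
Proof.
apply: integrable_local_Du; first exact: Cc_cutoff.
by move=> x /notin_sqdist/ltW; exact: cutoff_eq0.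
Qed.

Lemma integrable_cutoff_grad i : mu.-integrable setT (EFin \o cutoff_grad i).
Proof.
have := integrableD measurableT (integrable_cutoff_Du i) (Cc_integrable (Cc_pcutoff_u i)).
exact.
Qed.

(** Test the weak gradient of [u] in [Omega] with the cutoff times [phi]. The
    product lives on the whole space, where translations are available. *)
Lemma weak_partial_cutoff i : weak_partial i (fun x => cutoff x * u x) (cutoff_grad i).
Proof.
move=> phi tphi; have [sphi _ _] := tphi.
have cphi := smooth_continuous sphi.
have cdphi : continuous (partial i phi) by apply: smooth_continuous; exact: smooth_partial.
have [b [b0 phib]] := Cc_bounded (test_functionT_Cc tphi).
have mphi : measurable_fun setT phi by exact: continuous_measurable_rV.
have := wu (test_function_cutoff sphi) i.
move=> /(congr1 fine); rewrite fineN.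
rewrite -/(Rintegral mu Omega (fun x => u x * partial i (fun z => cutoff z * phi z) x)).
rewrite -/(Rintegral mu Omega (fun x => Du x ord0 i * (cutoff x * phi x))).
rewrite (@Rintegral_vanish _ _ _ mu Omega (fun x => u x * partial i (fun z => cutoff z * phi z) x)); last first.
  move=> x /notin_sqdist xr; rewrite partialM.
  + by rewrite cutoff_eq0 ?ltW// partial_cutoff_out// mul0r !mulr0 addr0 mulr0.
  + exact: smooth_derivable smooth_cutoff.
  + exact: smooth_derivable.
rewrite (@Rintegral_vanish _ _ _ mu Omega (fun x => Du x ord0 i * (cutoff x * phi x))); last first.
  by move=> x /notin_sqdist/ltW/cutoff_eq0 ->; rewrite mul0r mulr0.
have -> : (fun x => u x * partial i (fun z => cutoff z * phi z) x) =
    (fun x => cutoff x * u x * partial i phi x + partial i cutoff x * u x * phi x).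
  apply/funext => x; rewrite partialM; first by ring.
    exact: smooth_derivable smooth_cutoff.
  exact: smooth_derivable.
rewrite RintegralD//; first last.
- by apply: Cc_integrable; apply: Cc_mull => //; exact: Cc_pcutoff_u.
- by apply: Cc_integrable; apply: Cc_mull => //; exact: Cc_cutoff_u.
have -> : (fun x => cutoff_grad i x * phi x) =
    (fun x => cutoff x * Du x ord0 i * phi x + partial i cutoff x * u x * phi x).
  by apply/funext => x; rewrite /cutoff_grad mulrDl.
rewrite RintegralD//; first last.
- by apply: Cc_integrable; apply: Cc_mull => //; exact: Cc_pcutoff_u.
- exact: (integrable_mul_bounded measurableT (integrable_cutoff_Du i) mphi (fun x _ => phib x)).
have -> : (fun x => Du x ord0 i * (cutoff x * phi x)) = (fun x => cutoff x * Du x ord0 i * phi x).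
  by apply/funext => x; ring.
move: (Rintegral _ _ _) (Rintegral _ _ _) (Rintegral _ _ _) => a c d; lra.
Qed.

End cutoff.

(** * Comparison of energy minimizers with barriers *)

Section energy.
Variables (K : realType) (n : nat).
Notation mu := (lebesgue_rV n).
Implicit Types (Omega : set 'rV[K]_n) (x : 'rV[K]_n).

Lemma bounded_open_measure Omega : open Omega -> bounded_set Omega ->
  measurable Omega /\ (mu Omega < +oo)%E.
Proof.
move=> oO [M [_ HM]]; have mO := open_measurable_rV oO; split => //.
apply: le_lt_trans (lebesgue_rV_box_fin n (M + 1)).
apply: le_measure; rewrite ?inE//; first exact: measurable_rV_box.
by move=> x Ox /=; apply: (HM (M + 1)) => //; rewrite ltrDl.
Qed.

Lemma enorm_le_sum x : enorm x <= \sum_i `|x ord0 i|.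
Proof.
have S0 : 0 <= \sum_i `|x ord0 i| by apply: sumr_ge0.
rewrite -(@ler_pXn2r _ 2) ?nnegrE ?enorm_ge0// enorm_sqr expr2 mulr_suml.
apply: ler_sum => i _; rewrite -real_normK ?num_real// expr2 ler_wpM2l//.
by rewrite (bigD1 i)//= lerDl sumr_ge0.
Qed.

Lemma integrable_energy Omega (p : K) (Du : 'rV[K]_n -> 'rV[K]_n) : measurable Omega -> 1 <= p ->
  (forall i, (fun x => Du x ord0 i) \_ Omega \in Lfun mu p%:E) ->
  mu.-integrable Omega (EFin \o (fun x => enorm (Du x) `^ p)).
Proof.
move=> mO p1 LDu.
pose D i := (fun x => Du x ord0 i) \_ Omega.
have mD i : measurable_fun setT (D i) by exact: Lfun_measurable (LDu i).
pose f x := (\sum_i D i x ^+ 2) `^ 2^-1.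
have fE x : f x = ((fun x => enorm (Du x)) \_ Omega) x.
  rewrite /f powR12_sqrt; last by apply: sumr_ge0 => i _; exact: sqr_ge0.
  rewrite patchE; case: ifPn => Ox.
    by congr Num.sqrt; apply: eq_bigr => i _; rewrite /D patchE Ox.
  by rewrite big1 ?sqrtr0// => i _; rewrite /D patchE (negbTE Ox) expr0n.
have mf : measurable_fun setT f.
  apply: (measurableT_comp (measurable_powR _)).
  by apply: measurable_sum => i; apply: measurable_funX; exact: mD.
have Lh : (fun x => \sum_i `|D i x|) \in Lfun mu p%:E.
  have [L0 LD] := @Lfun_addr_closed _ _ _ mu p%:E p1.
  rewrite (_ : (fun x => _) = \sum_i (fun x => `|D i x|)); last first.
    by apply/funext => x; rewrite fct_sumE.
  elim/big_ind : _ => // i _; apply: (Lfun_le p1 _ (LDu i)) => [|x].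
    by apply: measurableT_comp => //; exact: mD.
  by rewrite normr_id.
have Lf : f \in Lfun mu p%:E.
  apply: (Lfun_le p1 mf Lh) => x.
  rewrite ger0_norm ?powR_ge0// ger0_norm ?sumr_ge0// fE patchE.
  case: ifPn => Ox; last exact: sumr_ge0.
  apply: le_trans (enorm_le_sum _) _; apply: ler_sum => i _; rewrite /D patchE Ox//.
have := Lfun_integrable p1 Lf => H.
apply: (integrable_mkcond _ mO).2.
apply: (eq_integrable measurableT _ _ _ H) => x _.
rewrite ger0_norm ?powR_ge0// fE !patchE; case: ifPn => // _.
by rewrite powR0// gt_eqF// (lt_le_trans ltr01).
Qed.

End energy.

Section comparison.
Variables (K : realType) (n : nat) (Omega : set 'rV[K]_n).
Notation mu := (lebesgue_rV n).
Hypotheses (oO : open Omega) (bO : bounded_set Omega).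
Variables (p : K) (g u : 'rV[K]_n -> K) (Du : 'rV[K]_n -> 'rV[K]_n).
Hypothesis p1 : 1 < p.
Hypothesis admu : admissible Omega p g u Du.
Hypothesis minu : forall v Dv, admissible Omega p g v Dv ->
  (energy Omega p Du <= energy Omega p Dv)%E.
Variables (y : 'rV[K]_n) (r0 rho1 rho A B ga M : K).
Hypotheses (r00 : 0 < r0) (r0rho1 : r0 < rho1) (rho1rho : rho1 < rho).
Hypotheses (B0 : 0 < B) (ga0 : 0 < ga) (M0 : 0 < M).
Hypothesis qn : n%:R < (1 - ga) * (p - 1) + 1.
Hypothesis ballO : forall x, enorm (x - y) <= rho -> Omega x.
Hypothesis u_near : forall x, enorm (x - y) <= r0 -> A <= u x.
Hypothesis u_far : forall x, rho1 <= enorm (x - y) -> enorm (x - y) <= rho ->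
  A - B * enorm (x - y) `^ ga <= u x.
Hypothesis u_M : forall x, enorm (x - y) <= rho -> A - u x <= M.
Implicit Types (x : 'rV[K]_n) (phi : 'rV[K]_n -> K).

Notation e_ i := (delta_mx (ord0 : 'I_1) i : 'rV[K]_n).
Let w := barrier y r0 A B ga.
Let chi := cutoff y rho1 rho.
Let z x := chi x * w x - chi x * u x.
Let P x := pos (z x).
Let V x := P x ^+ 2.
Let q := (1 - ga) * (p - 1) + 1.
Let p1' : 1 <= p := ltW p1.
Let rho10 : 0 < rho1 := lt_trans r00 r0rho1.
Let rho0 : 0 < rho := lt_trans rho10 rho1rho.

Let mO : measurable Omega := (bounded_open_measure oO bO).1.
Let finO : (mu Omega < +oo)%E := (bounded_open_measure oO bO).2.

Let cu x : Omega x -> {for x, continuous u}.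
Proof.
move=> Ox; have [cu' _ _] := admu.
have : {within Omega, continuous u} by apply: continuous_subspaceW cu'; exact: subset_closure.
by rewrite (continuous_open_subspace _ oO) => /(_ x); rewrite inE => /(_ Ox).
Qed.

Let wu : weak_gradient Omega u Du. Proof. by have [_ [_ _ ?] _] := admu. Qed.

Let LDu i : (fun x => Du x ord0 i) \_ Omega \in Lfun mu p%:E.
Proof. by have [_ [_ + _] _] := admu; exact. Qed.

Let Lu : u \_ Omega \in Lfun mu p%:E.
Proof. by have [_ [+ _ _] _] := admu; exact. Qed.

Let patch0 (f : 'rV[K]_n -> K) x : ~ Omega x -> (f \_ Omega) x = 0.
Proof. by move=> nOx; rewrite patchE memNset. Qed.

Let iDu i : mu.-integrable setT (EFin \o ((fun x => Du x ord0 i) \_ Omega)).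
Proof. by apply: (Lfun_integrable_support p1' mO finO _ (LDu i)) => x; exact: patch0. Qed.

Let iu : mu.-integrable setT (EFin \o (u \_ Omega)).
Proof. by apply: (Lfun_integrable_support p1' mO finO _ Lu) => x; exact: patch0. Qed.

Let integrable_patch (f : 'rV[K]_n -> K) : mu.-integrable setT (EFin \o (f \_ Omega)) ->
  mu.-integrable Omega (EFin \o f).
Proof.
move=> h; apply: (integrable_mkcond _ mO).2; apply: (eq_integrable measurableT _ _ _ h) => x _.
by rewrite /= !patchE; case: ifP.
Qed.

Let cw : continuous w. Proof. exact: (Ck_continuous (Ck_barrier y r00 A B ga 0)). Qed.
Let dw i x : derivable w x (e_ i).
Proof. by have [_ + _] := Ck_barrier y r00 A B ga 1; exact. Qed.
Let cdw i : continuous (partial i w).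
Proof. by have [_ _ +] := Ck_barrier y r00 A B ga 1; exact. Qed.
Let schi : smooth chi. Proof. exact: smooth_cutoff. Qed.
Let chiC : Cc chi. Proof. exact: Cc_cutoff. Qed.

Let Ck1_chiw : Ck 1 (fun x => chi x * w x).
Proof. by apply: Ck_mul; [exact: Ck_cutoff|exact: Ck_barrier]. Qed.

Let gz i x := partial i (fun x => chi x * w x) x - cutoff_grad y rho1 rho u Du i x.

Let chiwC : Cc (fun x => chi x * w x). Proof. exact: Cc_mull. Qed.
Let chiuC : Cc (fun x => chi x * u x). Proof. exact: (Cc_cutoff_u rho10 rho1rho ballO cu). Qed.
Let zC : Cc z. Proof. exact: Cc_sub. Qed.

Let dchiwC i : Cc (partial i (fun x => chi x * w x)).
Proof.
have [_ _ /(_ i) c] := Ck1_chiw; split; first exact: c.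
exists (`|y| + rho) => x /(norm_gt_sqdist rho10 rho1rho) xr.
apply: (@partial_near_cst _ _ _ _ 0); near=> t.
rewrite /chi cutoff_eq0 ?mul0r//; apply: ltW; near: t; exact: near_sqdist_gt.
Unshelve. all: by end_near.
Qed.

Let igz i : mu.-integrable setT (EFin \o gz i).
Proof.
have := integrableB measurableT (Cc_integrable (dchiwC i))
  (integrable_cutoff_grad rho10 rho1rho ballO cu iDu i).
exact.
Qed.

Let wz i : weak_partial i z (gz i).
Proof.
apply: weak_partialB => //.
- exact: Cc_integrable.
- exact: (integrable_cutoff_grad rho10 rho1rho ballO cu iDu i).
- have [c d dc] := Ck1_chiw; apply: weak_partial_C1 => // x; exact: d.
- exact: (weak_partial_cutoff rho10 rho1rho ballO cu wu iDu i).
Qed.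

Let zE x : z x = chi x * (w x - u x). Proof. by rewrite /z; ring. Qed.

(** Outside this annulus the boundary inequalities give w <= u, and beyond
    radius [rho] the cutoff vanishes. *)
Let z_supp x : 0 < z x -> r0 ^+ 2 < sqdist y x < rho1 ^+ 2.
Proof.
rewrite zE => z0; have c0 := cutoff_ge0 y rho1 rho x; rewrite -/(chi x) in c0.
have wu0 : u x < w x.
  rewrite -subr_gt0 ltNge; apply/negP => h.
  by move: z0; rewrite ltNge mulr_ge0_le0.
have xrho : enorm (x - y) < rho.
  rewrite -(sqdist_lt _ _ (ltW rho0)) ltNge; apply/negP => h.
  by move: z0; rewrite /chi cutoff_eq0// mul0r ltxx.
apply/andP; split.
  rewrite ltNge sqdist_le ?(ltW r00)//; apply/negP => /u_near.
  have := barrier_le_A y r0 A ga x (ltW B0); rewrite -/(w x) => h1 h2; lra.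
rewrite sqdist_lt ?(ltW rho10)// ltNge; apply/negP => h.
have := u_far h (ltW xrho); rewrite -(@barrierE _ _ y r0 A B ga x); first by rewrite -/(w x); lra.
have r0x : r0 <= enorm (x - y) := le_trans (ltW r0rho1) h.
by rewrite sqdist_enorm ler_pXn2r ?nnegrE ?enorm_ge0// ltW.
Qed.

Let P_supp x : P x != 0 -> r0 ^+ 2 < sqdist y x < rho1 ^+ 2.
Proof.
move=> Px; apply: z_supp; rewrite ltNge; apply: contra Px => z0.
by rewrite /P /pos max_r.
Qed.

Let P_ge0 x : 0 <= P x. Proof. exact: pos_ge0. Qed.

Let P_chi x : P x != 0 -> chi x = 1 /\ enorm (x - y) < rho1.
Proof.
move=> /P_supp/andP[_ h]; split; first by apply: cutoff_eq1 => //; exact: ltW.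
by rewrite -(sqdist_lt _ _ (ltW rho10)).
Qed.

Let P_out x : ~ Omega x -> P x = 0.
Proof.
move=> nOx; apply/eqP; apply/negPn/negP => /P_chi[_ h]; apply: nOx; apply: ballO; exact: ltW (lt_trans h rho1rho).
Qed.

Let P_le x : P x <= M.
Proof.
have [->|Px] := eqVneq (P x) 0; first exact: ltW.
have [c1 h] := P_chi Px; rewrite /P /pos ge_max (ltW M0) andbT zE c1 mul1r.
have := barrier_le_A y r0 A ga x (ltW B0); rewrite -/(w x).
have hr : enorm (x - y) <= rho := ltW (lt_trans h rho1rho).
have := u_M hr; lra.
Qed.

Let PC : Cc P. Proof. exact: Cc_pos. Qed.
Let cP : continuous P. Proof. by case: PC. Qed.
Let VC : Cc V.
Proof. by rewrite /V; under eq_fun do rewrite expr2; apply: Cc_mull. Qed.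
Let cV : continuous V. Proof. by case: VC. Qed.

Let T i x := P x * (partial i w x - Du x ord0 i).

(** On the support of [P] the cutoff is locally 1, so it leaves no trace in the
    gradient. *)
Let Pgz i x : P x * gz i x = T i x.
Proof.
rewrite /T; have [->|Px] := eqVneq (P x) 0; first by rewrite !mul0r.
have [c1 _] := P_chi Px; have /andP[_ h] := P_supp Px.
congr (_ * _); rewrite /gz /cutoff_grad partialM//; last exact: smooth_derivable.
by rewrite -/chi c1 partial_cutoff_eq0//; ring.
Qed.

Let T_out i x : ~ Omega x -> T i x = 0.
Proof. by move=> /P_out h; rewrite /T h mul0r. Qed.

Let iTphi i phi : continuous phi -> mu.-integrable setT (EFin \o (fun x => T i x * phi x)).
Proof.
move=> cphi.
have C1 : Cc (fun x => P x * phi x) by exact: Cc_mull.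
have C2 : Cc (fun x => P x * phi x * partial i w x) by exact: Cc_mull.
have I2 := @integrable_local_Du _ _ Omega Du iDu i _ C1.
have := integrableB measurableT (Cc_integrable C2) (I2 _).
move=> /(_ _)/eq_integrable; apply => //.
  by move=> x _ /=; rewrite -EFinB; congr (_%:E); rewrite /T; ring.
by move=> x /P_out h; rewrite h mul0r.
Qed.

Let intV i phi : continuous phi -> (forall x, derivable phi x (e_ i)) ->
  continuous (partial i phi) ->
  \int[mu]_x (V x * partial i phi x) = - (2 * \int[mu]_x (T i x * phi x)).
Proof.
move=> cphi dphi cdphi.
rewrite (weak_partial_pos_sqr zC (igz i) (@wz i) cphi dphi cdphi); congr (- _).
rewrite -RintegralZl//; last exact: iTphi.
by apply: eq_Rintegral => x _; rewrite -/(P x) -Pgz; ring.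
Qed.

Let v x := u x + V x / (2 * M).
Let Dv x := Du x + (P x / M) *: (grad_barrier y r0 A B ga x - Du x).

Let DvE x i : Dv x ord0 i = Du x ord0 i + T i x / M.
Proof. by rewrite /Dv !mxE /T -/w; ring. Qed.

Let V_out x : ~ Omega x -> V x = 0.
Proof. by move=> /P_out h; rewrite /V h expr0n. Qed.

Let Lv : v \_ Omega \in Lfun mu p%:E.
Proof.
have [_ LD] := @Lfun_addr_closed _ _ _ mu p%:E p1'.
have VC' : Cc (fun x => (2 * M)^-1 * V x) by exact: Cc_scale.
have [b [_ Vb]] := Cc_bounded VC'.
have -> : v \_ Omega = (u \_ Omega) + (fun x => (2 * M)^-1 * V x).
  apply/funext => x /=; rewrite -[RHS]/((u \_ Omega) x + (2 * M)^-1 * V x) !patchE.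
  case: ifPn => [_|]; first by rewrite /v mulrC.
  by rewrite notin_setE => /V_out ->; rewrite mulr0 addr0.
apply: LD => //; apply: (Lfun_bounded p1' mO finO _ _ Vb).
  by move=> x /V_out ->; rewrite mulr0.
by apply: continuous_measurable_rV; case: VC'.
Qed.

Let LDv i : (fun x => Dv x ord0 i) \_ Omega \in Lfun mu p%:E.
Proof.
have [_ LD] := @Lfun_addr_closed _ _ _ mu p%:E p1'.
have C1 : Cc (fun x => M^-1 * P x * partial i w x) by apply: Cc_mull => //; exact: Cc_scale.
have [b [_ Cb]] := Cc_bounded C1.
have cPM : continuous (fun x => - (M^-1 * P x)).
  by case: (Cc_opp (Cc_scale M^-1 PC)).
have -> : (fun x => Dv x ord0 i) \_ Omega = ((fun x => Du x ord0 i) \_ Omega) +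
   ((fun x => M^-1 * P x * partial i w x) + (fun x => - (M^-1 * P x) * ((fun x => Du x ord0 i) \_ Omega) x)).
  apply/funext => x /=.
  rewrite -[RHS]/(((fun x => Du x ord0 i) \_ Omega) x + (M^-1 * P x * partial i w x +
    - (M^-1 * P x) * ((fun x => Du x ord0 i) \_ Omega) x)) !patchE.
  case: ifPn => [_|]; first by rewrite DvE /T; ring.
  by rewrite notin_setE => /P_out ->; rewrite !(mulr0,mul0r,oppr0,addr0).
apply: (LD) => //; apply: (LD).
  apply: (Lfun_bounded p1' mO finO _ _ Cb).
    by move=> x /P_out ->; rewrite mulr0 mul0r.
  by apply: continuous_measurable_rV; case: C1.
apply: (Lfun_le p1' _ (LDu i)) => [|x].
  apply: measurable_funM; first exact: continuous_measurable_rV.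
  exact: Lfun_measurable (LDu i).
rewrite normrM ler_piMl// normrN ger0_norm; last by rewrite mulr_ge0 ?invr_ge0// ltW.
by rewrite mulrC ler_pdivrMr// mul1r.
Qed.

(** By the chain rule P^2 / (2 M) has weak gradient T / M, also when tested in
    [Omega], because it vanishes outside. *)
Let wv : weak_gradient Omega v Dv.
Proof.
move=> phi tphi i; have [sphi cphi0 _] := tphi.
have tphi' : test_function setT phi by split.
have cphi := smooth_continuous sphi.
have dphi x : derivable phi x (e_ i) by exact: smooth_derivable.
have cdphi : continuous (partial i phi) by apply: smooth_continuous; exact: smooth_partial.
have [b [_ phib]] := Cc_bounded (test_functionT_Cc tphi').
have [M' phiM] := test_functionT_vanish tphi'.
have dphiC : Cc (partial i phi).
  split => //; exists M' => x xM; apply: (@partial_near_cst _ _ _ _ 0); near=> t.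
  apply: phiM; near: t.
  by apply: open_nbhs_nbhs; split => //; exact: open_norm_gt.
have [b' [_ dphib]] := Cc_bounded dphiC.
have mphi D : measurable_fun D phi by exact: continuous_measurable_rV.
have mdphi D : measurable_fun D (partial i phi) by exact: continuous_measurable_rV.
have iu' := integrable_mul_bounded mO (integrable_patch iu) (mdphi _) (fun x _ => dphib x).
have iDu' := integrable_mul_bounded mO (integrable_patch (iDu i)) (mphi _) (fun x _ => phib x).
have iV : mu.-integrable setT (EFin \o (fun x => V x * partial i phi x)).
  by apply: Cc_integrable; exact: Cc_mull.
have iVO := integrableS measurableT mO (@subsetT _ Omega) iV.
have iTO := integrableS measurableT mO (@subsetT _ Omega) (@iTphi i phi cphi).
have E1 : \int[mu]_(x in Omega) (v x * partial i phi x) =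
   \int[mu]_(x in Omega) (u x * partial i phi x) + (2 * M)^-1 * \int[mu]_x (V x * partial i phi x).
  rewrite -(@Rintegral_vanish _ _ _ mu Omega (fun x => V x * partial i phi x)); last first.
    by move=> x /V_out ->; rewrite mul0r.
  rewrite -RintegralZl// -RintegralD//.
    by apply: eq_Rintegral => x _; rewrite /v; ring.
  exact: (integrableZl mO _ iVO).
have E2 : \int[mu]_(x in Omega) (Dv x ord0 i * phi x) =
   \int[mu]_(x in Omega) (Du x ord0 i * phi x) + M^-1 * \int[mu]_x (T i x * phi x).
  rewrite -(@Rintegral_vanish _ _ _ mu Omega (fun x => T i x * phi x)); last first.
    by move=> x /T_out ->; rewrite mul0r.
  rewrite -RintegralZl// -RintegralD//.
    by apply: eq_Rintegral => x _; rewrite DvE; ring.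
  exact: (integrableZl mO _ iTO).
have Eu : \int[mu]_(x in Omega) (u x * partial i phi x) =
    - (\int[mu]_(x in Omega) (Du x ord0 i * phi x)).
  by have /(congr1 fine) := wu tphi i; rewrite fineN.
have iv' : mu.-integrable Omega (EFin \o (fun x => v x * partial i phi x)).
  have iv : mu.-integrable setT (EFin \o (v \_ Omega)).
    by apply: (Lfun_integrable_support p1' mO finO _ Lv) => x; exact: patch0.
  exact: (integrable_mul_bounded mO (integrable_patch iv) (mdphi _) (fun x _ => dphib x)).
have iDv' : mu.-integrable Omega (EFin \o (fun x => Dv x ord0 i * phi x)).
  have iv : mu.-integrable setT (EFin \o ((fun x => Dv x ord0 i) \_ Omega)).
    by apply: (Lfun_integrable_support p1' mO finO _ (LDv i)) => x; exact: patch0.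
  exact: (integrable_mul_bounded mO (integrable_patch iv) (mphi _) (fun x _ => phib x)).
rewrite -[LHS]fineK; last exact: (integrable_fin_num mO iv').
rewrite -[X in (- X)%E]fineK; last exact: (integrable_fin_num mO iDv').
rewrite -EFinN; congr (_%:E).
rewrite -/(Rintegral mu Omega (fun x => v x * partial i phi x)).
rewrite -/(Rintegral mu Omega (fun x => Dv x ord0 i * phi x)).
rewrite E1 E2 Eu (intV cphi dphi cdphi).
move: (Rintegral _ _ _) (Rintegral _ _ _) => a c.
by field; rewrite gt_eqF.
Unshelve. all: by end_near.
Qed.

Let admv : admissible Omega p g v Dv.
Proof.
have [cu' _ gu] := admu; split.
- have cV' : {within closure Omega, continuous (fun x => V x / (2 * M))}.
    by apply: continuous_subspaceT => x; apply: continuousM; [exact: cV|exact: cst_continuous].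
  by move=> x; exact: (continuousD (cu' x) (cV' x)).
- split; [exact: Lv|exact: LDv|exact: wv].
- move=> x xb; rewrite /v V_out ?mul0r ?addr0; first exact: gu.
  by move: xb; rewrite inE => -[_]; rewrite (interior_id _).1.
Qed.

(** [Dv] lies on the segment from [Du] to the gradient of the barrier, at the
    fraction P / M in [0, 1]. *)
Let energy_pointwise x : enorm (Dv x) `^ p <= enorm (Du x) `^ p +
  p / M * ((B * ga) `^ (p - 2) * (B * ga)) * \sum_i T i x * flux y r0 q i x.
Proof.
have [Px|Px] := eqVneq (P x) 0.
  rewrite /Dv Px mul0r scale0r addr0 big1 ?mulr0 ?addr0// => i _.
  by rewrite /T Px !mul0r.
have /andP[/ltW h _] := P_supp Px.
have sq0 : 0 < sqdist y x by apply: lt_le_trans h; rewrite exprn_gt0.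
have G0 : 0 < enorm (grad_barrier y r0 A B ga x).
  by rewrite enorm_grad_barrier// !mulr_gt0// powR_gt0.
have t01 : 0 <= P x / M <= 1.
  by rewrite divr_ge0 ?(ltW M0)//= ler_pdivrMr// mul1r P_le.
apply: le_trans (enorm_powR_tangent (Du x) p1 t01 G0) _.
rewrite lerD2l le_eqVlt; apply/orP; left; apply/eqP.
rewrite !mulr_sumr; apply: eq_bigr => i _.
rewrite flux_barrier// -/q /T mxE -/w; ring.
Qed.

(** Integrate [energy_pointwise] and use minimality: the integral of
    P^2 div(flux) is at most 0, while the integrand is positive where P is. *)
Let V_eq0 x : V x = 0.
Proof.
pose c := (B * ga) `^ (p - 2) * (B * ga).
have Bga : 0 < B * ga by rewrite mulr_gt0.
have c0 : 0 < c by rewrite mulr_gt0// powR_gt0.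
have iDu0 := integrable_energy mO p1' LDu.
have iDv0 := integrable_energy mO p1' LDv.
have Ck1f i := Ck_flux y r00 q 1 i.
have cf i : continuous (flux y r0 q i) by exact: Ck_continuous (Ck1f i).
have df i t : derivable (flux y r0 q i) t (e_ i) by have [_ + _] := Ck1f i; exact.
have cdf i : continuous (partial i (flux y r0 q i)) by have [_ _ +] := Ck1f i; exact.
have iTf i := @iTphi i (flux y r0 q i) (cf i).
have iTfO i := integrableS measurableT mO (@subsetT _ Omega) (iTf i).
have [iS ES] := Rintegral_sum (index_enum 'I_n) mO iTfO.
pose k := p / M * c.
have k0 : 0 < k by rewrite mulr_gt0// divr_gt0// (lt_trans ltr01 p1).
have S0 : 0 <= \int[mu]_(x in Omega) (\sum_i T i x * flux y r0 q i x).
  have le1 : \int[mu]_(x in Omega) (enorm (Du x) `^ p) <= \int[mu]_(x in Omega) (enorm (Dv x) `^ p).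
    have := minu admv; rewrite /energy.
    rewrite -[X in (X <= _)%E]fineK; last exact: (integrable_fin_num mO iDu0).
    rewrite -[X in (_ <= X)%E]fineK; last exact: (integrable_fin_num mO iDv0).
    by rewrite lee_fin.
  have ikS : mu.-integrable Omega (EFin \o (fun x => k * \sum_i T i x * flux y r0 q i x)).
    exact: (integrableZl mO k iS).
  have le2 : \int[mu]_(x in Omega) (enorm (Dv x) `^ p) <=
      \int[mu]_(x in Omega) (enorm (Du x) `^ p + k * \sum_i T i x * flux y r0 q i x).
    apply: (le_Rintegral mO iDv0 (integrableD mO iDu0 ikS)) => t _.
    exact: energy_pointwise.
  have := le_trans le1 le2; rewrite RintegralD// lerDl RintegralZl//.
  by rewrite pmulr_rge0.
have {}S0 : \sum_i \int[mu]_x (V x * partial i (flux y r0 q i) x) <= 0.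
  move: S0; rewrite ES => S0; rewrite -oppr_ge0 -sumrN.
  rewrite (eq_bigr (fun i => 2 * \int[mu]_(x in Omega) (T i x * flux y r0 q i x))).
    by rewrite -mulr_sumr mulr_ge0.
  move=> i _; rewrite (intV (cf i) (df i) (cdf i)) opprK; congr (_ * _).
  by apply/esym/Rintegral_vanish => t /T_out ->; rewrite mul0r.
have iVf i : mu.-integrable setT (EFin \o (fun x => V x * partial i (flux y r0 q i) x)).
  by apply: Cc_integrable; exact: Cc_mull.
have [_ EV] := Rintegral_sum (index_enum 'I_n) measurableT iVf.
rewrite -EV in S0.
have fE t : \sum_i V t * partial i (flux y r0 q i) t = V t * ((q - n%:R) * sqdist y t `^ (- q / 2)).
  have [Pt|Pt] := eqVneq (P t) 0.
    by rewrite /V Pt expr0n/= mul0r big1// => i _; rewrite mul0r.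
  have /andP[/ltW h _] := P_supp Pt.
  by rewrite -mulr_sumr divergence_flux.
have fC : Cc (fun t => \sum_i V t * partial i (flux y r0 q i) t).
  have -> : (fun t => \sum_i V t * partial i (flux y r0 q i) t) =
      (fun t => V t * \sum_i partial i (flux y r0 q i) t).
    by apply/funext => t; rewrite mulr_sumr.
  apply: Cc_mull => //.
  exact: (Ck_continuous (Ck_sum (m := 0) (index_enum 'I_n) cdf)).
have f0 t : 0 <= \sum_i V t * partial i (flux y r0 q i) t.
  by rewrite fE mulr_ge0 ?sqr_ge0// mulr_ge0 ?powR_ge0// subr_ge0 ltW.
have := Cc_Rintegral_le0 fC f0 S0 x; rewrite fE => /eqP.
have [Px _|Px] := eqVneq (P x) 0; first by rewrite /V Px expr0n.
have /andP[/(lt_trans _) h _] := P_supp Px.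
have sq0 : 0 < sqdist y x by apply: h; rewrite exprn_gt0.
by rewrite mulf_eq0 => /orP[/eqP//|]; rewrite gt_eqF// mulr_gt0 ?powR_gt0// subr_gt0.
Qed.

(** A competitor with smaller energy exists unless the positive part of
    barrier minus [u] vanishes. The hypotheses [u_near] and [u_far] confine that
    positive part to the annulus between the radii [r0] and [rho1]. *)
Lemma barrier_comparison x : r0 <= enorm (x - y) -> enorm (x - y) <= rho ->
  A - B * enorm (x - y) `^ ga <= u x.
Proof.
move=> xr0 xrho; have [/u_far|xrho1] := leP rho1 (enorm (x - y)); first exact.
have x0 : r0 ^+ 2 <= sqdist y x.
  by rewrite sqdist_enorm ler_pXn2r ?nnegrE ?enorm_ge0// ltW.
rewrite -(barrierE _ _ _ x0) -/w -subr_le0.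
have := V_eq0 x => /eqP; rewrite /V sqrf_eq0 => /eqP Px.
have : z x <= P x by rewrite /P /pos le_max lexx.
by rewrite Px zE /chi cutoff_eq1 ?mul1r// sqdist_le ?(ltW rho10)// ltW.
Qed.

End comparison.

(** * Comparison with cones and the Harnack inequality *)

Section cone.
Variables (K : realType) (n : nat).
Implicit Types (Omega : set 'rV[K]_n) (x y : 'rV[K]_n) (u : 'rV[K]_n -> K).

Lemma uniform_cvg_near Omega (up : nat -> 'rV[K]_n -> K) u (e : K) : 0 < e ->
  {uniform Omega, up @ \oo --> u} ->
  \forall j \near \oo, forall x, Omega x -> `|u x - up j x| < e.
Proof.
move=> e0 cv.
have H : nbhs (u : {uniform` Omega -> K}) [set h : {uniform` Omega -> K} | forall x, Omega x -> `|u x - h x| < e].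
  apply/uniform_nbhs.
  exists [set xy | ball xy.1 e xy.2]; split; first exact: (entourage_ball K (PosNum e0)).
  by move=> h /= H x Ox; have := H x Ox; rewrite -ball_normE.
exact: (cv _ H).
Qed.

(** The exponent is explicit: t^ga = t * exp ((1 - ga) * - ln t). *)
Lemma powR_exponent_near1 (t e : K) : 0 < t -> t < 1 -> 0 < e ->
  exists ga : K, [/\ 0 < ga, ga < 1 & t `^ ga <= t + e].
Proof.
move=> t0 t1 e0; pose L := - ln t.
have L0 : 0 < L by rewrite oppr_gt0 ln_lt0// t0.
have le0 : 0 < ln (1 + e) by rewrite ln_gt0// ltrDl.
pose d := Num.min (ln (1 + e) / L) (1 / 2).
have d0 : 0 < d by rewrite lt_min !divr_gt0.
have d2 : d <= 1 / 2 by rewrite ge_min lexx orbT.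
have dL : d * L <= ln (1 + e) by rewrite -ler_pdivlMr// ge_min lexx.
exists (1 - d); split; [lra|lra|].
have -> : t `^ (1 - d) = t * expR (d * L).
  by rewrite /powR gt_eqF// mulrBl mul1r expRD lnK ?posrE// /L mulrN.
apply: (@le_trans _ _ (t * (1 + e))).
  by rewrite ler_pM2l// -[leRHS]lnK ?posrE ?ler_expR// ltr_pwDl// ltW.
by rewrite mulrDr mulr1 lerD2l ler_piMl// ltW.
Qed.

(** If the inequality fails at [x] by 5 [eta], compare a minimizer
    u_p within [eta] of [u] with the barrier of height u(y) - 2 [eta] at [y] that
    drops by u(y) over the distance [rho]. Near [y] the continuity of [u] puts u_p
    above it; near distance [rho] the barrier is at most - [eta] and u_p is at
    least - [eta] because [u] is nonnegative. *)
Lemma cone_comparison Omega u y x (rho : K) : bounded_domain Omega ->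
  variational_solution Omega u -> (forall x, Omega x -> 0 <= u x) ->
  (forall x, enorm (x - y) <= rho -> Omega x) ->
  enorm (x - y) < rho -> u y * (1 - enorm (x - y) / rho) <= u x.
Proof.
move=> [oO _ _ bO] [cu [g [p [up [_ p2 poo minp upu]]]]] u0 ballO xrho.
have rho0 : 0 < rho by exact: le_lt_trans (enorm_ge0 _) xrho.
have Oy : Omega y.
  by apply: ballO; rewrite subrr -[0]/(0 : 'rV[K]_n) -(scale0r (0 : 'rV[K]_n)) enormZ normr0 mul0r ltW.
have Ox : Omega x by apply: ballO; exact: ltW.
pose a := u y; pose s := enorm (x - y).
rewrite -/a -/s.
have [/eqP s0|s0] := eqVneq s 0.
  have /eqP := s0; rewrite /s => /eqP/eqP/enorm0_eq0/eqP; rewrite subr_eq0 => /eqP ->.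
  by rewrite subrr -(scale0r (0 : 'rV[K]_n)) enormZ normr0 !mul0r subr0 mulr1.
have {}s0 : 0 < s by rewrite lt_neqAle eq_sym s0 enorm_ge0.
have [a0|a0] := leP a 0.
  have -> : a = 0 by apply/eqP; rewrite eq_le a0 u0.
  by rewrite mul0r u0.
rewrite leNgt; apply/negP => ux.
pose t := s / rho.
have t0 : 0 < t by rewrite divr_gt0.
have t1 : t < 1 by rewrite ltr_pdivrMr// mul1r.
(* room for five errors: two for the height A, one for ga, one each for u_p at x and the margin *)
pose eta := (a * (1 - t) - u x) / 5.
have eta0 : 0 < eta by rewrite divr_gt0// subr_gt0.
have eta1 : 5 * eta <= a * (1 - t) - u x by rewrite mulrC -ler_pdivlMr.
have [ga [ga0 ga1 tga]] := powR_exponent_near1 t0 t1 (divr_gt0 eta0 a0).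
pose B := a / rho `^ ga.
have rga0 : 0 < rho `^ ga by rewrite powR_gt0.
have B0 : 0 < B by rewrite divr_gt0.
have BE (l : K) : 0 <= l -> B * l `^ ga = a * (l / rho) `^ ga.
  move=> l0; rewrite powRM ?invr_ge0 ?(ltW rho0)// /B -mulrA; congr (_ * _).
  rewrite mulrC; congr (_ * _); rewrite -[rho^-1]powR_inv1 ?(ltW rho0)// powRAC.
  by rewrite powR_inv1// ltW.
(* beyond rho1 even the cone is below eta; rho1 must also exceed s *)
pose rho1 := Num.max (rho * (1 - eta / a)) ((s + rho) / 2).
have srho : s < rho := xrho.
have rho1s : s < rho1 by rewrite lt_max; apply/orP; right; lra.
have rho1rho : rho1 < rho.
  rewrite gt_max; apply/andP; split; last by lra.
  by rewrite gtr_pMr// gtrBl divr_gt0.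
have rho1e : rho * (1 - eta / a) <= rho1 by rewrite le_max lexx.
have cuy : {for y, continuous u}.
  have : {within Omega, continuous u} by apply: continuous_subspaceW cu; exact: subset_closure.
  by rewrite (continuous_open_subspace _ oO) => /(_ y); rewrite inE => /(_ Oy).
have [r0 [r00 r0s u_near]] : exists r0 : K, [/\ 0 < r0, r0 < s &
    forall z, enorm (z - y) <= r0 -> a - eta <= u z].
  have /cvgrPdist_lt/(_ _ eta0)/nbhs_ballP[d /= d0 dH] := cuy.
  exists (Num.min (d / 2) (s / 2)); split.
  - by rewrite lt_min !divr_gt0.
  - by rewrite gt_min; apply/orP; right; lra.
  - move=> z; rewrite le_min => /andP[zd _].
    have : ball y d z.
      rewrite -ball_normE /= distrC (le_lt_trans (norm_le_enorm _))//; lra.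
    by move/dH; rewrite ltr_norml -/a => /andP[]; lra.
have H1 := uniform_cvg_near eta0 upu.
have H2 : \forall j \near \oo, 1 + n%:R / (1 - ga) < p j.
  by move/cvgryPgt : poo; exact.
near \oo => j.
have upj : forall z, closure Omega z -> `|u z - up j z| < eta by near: j.
have pj : 1 + n%:R / (1 - ga) < p j by near: j.
have [Du adm minj] := minp j.
have [_ p2j] := p2 j.
have p1 : 1 < p j by lra.
have qn : n%:R < (1 - ga) * (p j - 1) + 1.
  have ga1' : 0 < 1 - ga by lra.
  have : n%:R / (1 - ga) < p j - 1 by lra.
  by rewrite ltr_pdivrMr// mulrC; lra.
have upO z : Omega z -> u z - eta <= up j z /\ up j z <= u z + eta.
  move=> /subset_closure/upj; rewrite ltr_norml => /andP[]; lra.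
have nearA z : enorm (z - y) <= r0 -> a - 2 * eta <= up j z.
  move=> zr; have := u_near z zr; have [|+ _] := upO z; last by lra.
  by apply: ballO; rewrite (le_trans zr)// ltW// (lt_trans r0s).
have farA z : rho1 <= enorm (z - y) -> enorm (z - y) <= rho ->
    a - 2 * eta - B * enorm (z - y) `^ ga <= up j z.
  move=> zr1 zr; have Oz := ballO z zr.
  have [up1 _] := upO z Oz; have uz := u0 z Oz.
  rewrite BE ?enorm_ge0//.
  set l := enorm (z - y) / rho.
  have l1 : l <= 1 by rewrite ler_pdivrMr// mul1r.
  have l0 : 0 < l.
    by rewrite divr_gt0//; apply: lt_le_trans zr1; exact: lt_trans rho1s.
  have le1 : 1 - eta / a <= l by rewrite ler_pdivlMr// mulrC (le_trans rho1e).
  have lga : l <= l `^ ga by apply: ger1_powR; [rewrite l0 l1|exact: ltW].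
  have : a * (1 - eta / a) <= a * l `^ ga by rewrite ler_pM2l// (le_trans le1).
  have -> : a * (1 - eta / a) = a - eta by field; rewrite gt_eqF.
  lra.
have MA z : enorm (z - y) <= rho -> a - 2 * eta - up j z <= a.
  move=> zr; have Oz := ballO z zr.
  by have [up1 _] := upO z Oz; have uz := u0 z Oz; lra.
have := @barrier_comparison K n Omega oO bO (p j) g (up j) Du p1 adm minj y r0 rho1 rho
  (a - 2 * eta) B ga a r00 (lt_trans r0s rho1s) rho1rho B0 ga0 a0 qn ballO nearA farA MA x
  (ltW r0s) (ltW xrho).
rewrite -/s BE ?(ltW s0)// -/t.
have : a * t `^ ga <= a * t + eta.
  rewrite (le_trans (_ : _ <= a * (t + eta / a)))//; first by rewrite ler_pM2l.
  have -> : a * (t + eta / a) = a * t + eta by field; rewrite gt_eqF.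
  exact: lexx.
have [_ upx] := upO x Ox.
lra.
Unshelve. all: by end_near.
Qed.

(** 1 / (1 - s) = 1 + s / (1 - s) <= exp (s / (1 - s)). *)
Lemma expR_lower (s : K) : s < 1 -> expR (- (s / (1 - s))) <= 1 - s.
Proof.
move=> s1; have s10 : 0 < 1 - s by lra.
rewrite expRN -[leRHS]invrK lef_pV2 ?posrE ?expR_gt0 ?invr_gt0//.
apply: le_trans (expR_ge1Dx _).
by rewrite le_eqVlt; apply/orP; left; apply/eqP; field; rewrite gt_eqF.
Qed.

Lemma le_expR_of_le_powers (c b t : K) : 0 <= c -> 0 <= t ->
  (forall N, t < N.+1%:R -> c * (1 - t / N.+1%:R) ^+ N.+1 <= b) -> c * expR (- t) <= b.
Proof.
move=> c0 t0 H; apply/ler_addgt0Pr => e e0.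
pose d := e / (c + 1).
have d0 : 0 < d by rewrite divr_gt0// ltr_wpDl.
(* then s = t / (N + 1) <= 1/2, and t / (1 - s) exceeds t by at most 2 t s <= d *)
pose N := Num.bound (2 * t + 2 * t ^+ 2 / d).
have bN : 2 * t + 2 * t ^+ 2 / d < N.+1%:R.
  apply: (@lt_trans _ _ N%:R); last by rewrite ltr_nat.
  apply: archi_boundP; rewrite addr_ge0 ?mulr_ge0// ?invr_ge0 ?sqr_ge0//; exact: ltW.
have sq0 : 0 <= 2 * t ^+ 2 / d by rewrite !mulr_ge0 ?invr_ge0 ?sqr_ge0// ltW.
have m0 : 0 < N.+1%:R :> K by rewrite ltr0n.
set m : K := N.+1%:R in bN m0.
pose s := t / m.
have tm : t < m by lra.
have s2 : s <= 1 / 2 by rewrite ler_pdivrMr//; lra.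
have s0 : 0 <= s by rewrite divr_ge0// ltW.
have := H N tm; rewrite -/m -/s => HN.
have s1 : s < 1 by lra.
have ts : t * s <= d / 2.
  rewrite /s mulrA -expr2 ler_pdivrMr//.
  have : 2 * t ^+ 2 / d <= m by lra.
  by rewrite ler_pdivrMr//; lra.
have E : expR (- t) * (1 - d) <= (1 - s) ^+ N.+1.
  apply: (@le_trans _ _ (expR (- (s / (1 - s))) ^+ N.+1)); last first.
    by rewrite lerXn2r ?nnegrE ?expR_ge0 ?expR_lower//; lra.
  rewrite -expRM_natl -/m.
  apply: (@le_trans _ _ (expR (- t) * expR (- d))).
    by rewrite ler_pM2l ?expR_gt0// (le_trans _ (expR_ge1Dx _)).
  rewrite -expRD ler_expR mulrN -opprD lerN2 mulrA.
  have -> : m * s = t by rewrite /s mulrC mulfVK// gt_eqF.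
  rewrite ler_pdivrMr; last by lra.
  have ds : d * s <= d / 2 by rewrite ler_pM2l//; lra.
  lra.
have cd : c * d <= e.
  by rewrite /d mulrCA ler_piMr ?(ltW e0)// ler_pdivrMr ?ltr_wpDl// mul1r lerDl.
have e1 : expR (- t) <= 1 by rewrite -[leRHS]expR0 ler_expR oppr_le0.
have := ler_wpM2l c0 E.
have : c * (expR (- t) * d) <= e.
  by rewrite (le_trans _ cd)// ler_wpM2l// ler_piMl// ltW.
lra.
Qed.

End cone.

Theorem theorem6 (K : realType) (n : nat) (Omega : set 'rV[K]_n)
    (u : 'rV[K]_n -> K)
    (hOmega : bounded_domain Omega)
    (hu : variational_solution Omega u)
    (u_ge0 : forall x, Omega x -> 0 <= u x)
    (x0 x y : 'rV[K]_n) (r R : K)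
    (hr : 0 < r) (hrR : r < R)
    (hball : closure (eball x0 R) `<=` Omega)
    (hx : eball x0 r x) (hy : eball x0 r y) :
  u x <= u y * expR (enorm (x - y) / (R - r)).
Proof.
have rho0 : 0 < R - r by rewrite subr_gt0.
pose t := enorm (x - y) / (R - r).
have t0 : 0 <= t by rewrite divr_ge0 ?enorm_ge0// ltW.
have ballO z w : enorm (z - x0) < r -> enorm (w - z) <= R - r -> Omega w.
  move=> zr wz; apply: hball; apply: subset_closure => /=; rewrite /eball/=.
  have -> : w - x0 = (w - z) + (z - x0) by rewrite addrA subrK.
  rewrite (le_lt_trans (enorm_triangle _ _))//; lra.
have seg (l : K) : 0 <= l <= 1 -> enorm (x + l *: (y - x) - x0) < r.
  move=> /andP[l0 l1].
  have -> : x + l *: (y - x) - x0 = (1 - l) *: (x - x0) + l *: (y - x0).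
    by apply/rowP => i; rewrite !mxE; ring.
  rewrite (le_lt_trans (enorm_triangle _ _))// !enormZ !ger0_norm ?subr_ge0//.
  have hx' : enorm (x - x0) < r := hx; have hy' : enorm (y - x0) < r := hy.
  have h2 : l * enorm (y - x0) <= l * r by rewrite ler_wpM2l// ltW.
  have [l1'|l1'] := ltP l 1.
    have : (1 - l) * enorm (x - x0) < (1 - l) * r by rewrite ltr_pM2l// subr_gt0.
    lra.
  have -> : l = 1 by apply/eqP; rewrite eq_le l1 l1'.
  by rewrite subrr mul0r add0r mul1r.
have Ox : Omega x by apply: (ballO x) => //; rewrite subrr -(scale0r (0 : 'rV[K]_n)) enormZ normr0 mul0r ltW.
have Oy : Omega y by apply: (ballO y) => //; rewrite subrr -(scale0r (0 : 'rV[K]_n)) enormZ normr0 mul0r ltW.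
suff : u x * expR (- t) <= u y by rewrite expRN ler_pdivrMr ?expR_gt0.
apply: le_expR_of_le_powers => //; first exact: u_ge0.
move=> N tN.
have m0 : 0 < N.+1%:R :> K by rewrite ltr0n.
set m : K := N.+1%:R in tN m0 *.
pose z (k : nat) := x + (k%:R / m) *: (y - x).
have zN : z N.+1 = y by rewrite /z divff ?gt_eqF// scale1r addrC subrK.
rewrite -zN.
have : forall k, (k <= N.+1)%N -> u x * (1 - t / m) ^+ k <= u (z k).
  elim=> [_|k IH kN]; first by rewrite expr0 mulr1 /z mul0r scale0r addr0.
  have lk j : (j <= N.+1)%N -> 0 <= j%:R / m <= 1.
    move=> jN; rewrite divr_ge0 ?(ltW m0)//= ler_pdivrMr// mul1r ler_nat//.
  have zk := seg _ (lk k (ltnW kN)).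
  have dz : enorm (z k.+1 - z k) / (R - r) = t / m.
    have -> : z k.+1 - z k = m^-1 *: (y - x).
      by apply/rowP => i; rewrite !mxE -natr1; ring.
    rewrite enormZ ger0_norm ?invr_ge0 ?(ltW m0)// enorm_distC /t; ring.
  have s1 : t / m < 1 by rewrite ltr_pdivrMr// mul1r.
  have := @cone_comparison K n Omega u (z k) (z k.+1) (R - r) hOmega hu u_ge0 (fun w => ballO (z k) w zk).
  rewrite dz => H; rewrite exprSr mulrA.
  apply: le_trans (H _); last by rewrite -(ltr_pM2r (x := (R - r)^-1)) ?invr_gt0// dz divff ?gt_eqF.
  by rewrite ler_wpM2r ?IH ?(ltnW kN)// subr_ge0 ltW.
exact.
Qed.
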